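(* Let $\Omega\subset\mathbb{R}^d$, $d\in\{2,3\}$, be a polygonal (polyhedral) domain and let $f\in L^2(\Omega)^d$. Let $\{X^h\}$ be a family of conforming velocity finite element spaces, indexed by the meshwidth $h$, of continuous piecewise polynomial vector fields vanishing on $\partial\Omega$, each with a basis $\{\phi_1,\dots,\phi_N\}$, satisfying: (A1) (inverse estimate) $\|\nabla v\|\le C h^{-1}\|v\|$ for all $v\in X^h$; (A2) (norm equivalence) with $N=Ch^{-d}$, for $v=\sum_{i=1}^N a_i\phi_i$ the quantities $\|v\|$ and $\sqrt{\tfrac1N\sum_{i=1}^N a_i^2}$ are equivalent norms with equivalence constants independent of $h$. For a penalty parameter $\varepsilon>0$, let $u^\varepsilon\in X^h$ be the solution of $$(\nabla u^\varepsilon,\nabla v)+\varepsilon^{-1}(\nabla\cdot u^\varepsilon,\nabla\cdot v)=(f,v)\quad\text{for all } v\in X^h,$$ write $u^\varepsilon=\sum_{i=1}^N c_i\phi_i$ with coefficient vector $c=(c_1,\dots,c_N)^T$, and let $A$ be the $N\times N$ matrix $A_{ij}=(\nabla\phi_i,\nabla\phi_j)+\varepsilon^{-1}(\nabla\cdot\phi_i,\nabla\cdot\phi_j)$, so that $Ac=b$ with $b_j=(f,\phi_j)$. Let $|\cdot|$ denote the Euclidean vector norm and the induced matrix norm, let $\kappa=|A||A^{-1}|$, and let $\kappa(u^\varepsilon):=\kappa(c)=|A^{-1}|\,|Ac|/|c|$. Let $f^h$ be the $L^2(\Omega)$-projection of $f$ into $X^h$. Then there is a constant $C$ independent of $h$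 and $\varepsilon$ such that $$\max_{f^h}\kappa(u^\varepsilon)=\kappa\le C\left(h^{-2}+\varepsilon^{-1}h^{-2}\right),$$ $$\kappa(u^\varepsilon)\le C\,\frac{\|f^h\|}{\|u^\varepsilon\|},\qquad\text{and}\qquad \kappa(u^\varepsilon)\le C h^{-2}\left(1+\frac{h}{\varepsilon}\,\frac{\|\nabla\cdot u^\varepsilon\|}{\|u^\varepsilon\|}\right).$$
   Context: $(\cdot,\cdot)$ and $\|\cdot\|$ denote the $L^2(\Omega)$ inner product and norm. The problem is the penalty approximation of the Stokes problem $-\Delta u+\nabla p=f$, $\nabla\cdot u=0$ in $\Omega$, $u=0$ on $\partial\Omega$. The generic constants $C$ in (A1), (A2) and the conclusion are independent of $h$ and $\varepsilon$. The effective condition number (condition number at the solution) of a nonsingular system $Ac=b$ is $\kappa(c)=|A^{-1}|\,|Ac|/|c|$. The maximum in the first assertion is over the right-hand side data $f^h\in X^h$. *)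

(* Defs.v *)
From HB Require Import structures.
From mathcomp Require Import all_boot all_order all_algebra.
From mathcomp Require Import all_classical all_reals all_analysis.
Set Implicit Arguments. Unset Strict Implicit. Unset Printing Implicit Defensive.
Import Order.TTheory GRing.Theory Num.Theory.
Import numFieldNormedType.Exports.
Local Open Scope classical_set_scope.
Local Open Scope ring_scope.

Section FEdefs.
Variable R : realType.

Definition enorm (d : nat) (x : 'rV[R]_d) : R := Num.sqrt (\sum_i x ord0 i ^+ 2).

Definition vnorm (n : nat) (x : 'cV[R]_n) : R := Num.sqrt (\sum_i x i ord0 ^+ 2).
Definition opnorm (n : nat) (M : 'M[R]_n) : R :=
  sup [set vnorm (M *m x) / vnorm x | x in [set: 'cV[R]_n]].
Definition cond (n : nat) (A : 'M[R]_n) : R := opnorm A * opnorm (invmx A).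
Definition eff_cond (n : nat) (A : 'M[R]_n) (c : 'cV[R]_n) : R :=
  opnorm (invmx A) * vnorm (A *m c) / vnorm c.

Fixpoint iint (n : nat) : ('rV[R]_n -> R) -> R :=
  match n return ('rV[R]_n -> R) -> R with
  | 0 => fun g => g 0
  | n'.+1 => fun g => Rintegral lebesgue_measure setT
                        (fun x : R => iint (fun y : 'rV[R]_n' => g (row_mx (\row_(_ < 1) x) y)))
  end.

Fixpoint iintE (n : nat) : ('rV[R]_n -> \bar R) -> \bar R :=
  match n return ('rV[R]_n -> \bar R) -> \bar R with
  | 0 => fun g => g 0
  | n'.+1 => fun g => (\int[lebesgue_measure]_(x in setT)
                        iintE (fun y : 'rV[R]_n' => g (row_mx (\row_(_ < 1) x) y)))%E
  end.

Definition intOm (d : nat) (Om : set 'rV[R]_d) (g : 'rV[R]_d -> R) : R :=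
  iint (fun x => \1_Om x * g x).

Notation vfield d := ('rV[R]_d -> 'rV[R]_d).

Definition ip (d : nat) (Om : set 'rV[R]_d) (v w : vfield d) : R :=
  intOm Om (fun x => \sum_i v x ord0 i * w x ord0 i).
Definition l2norm d (Om : set 'rV[R]_d) (v : vfield d) : R := Num.sqrt (ip Om v v).

Definition L2vec d (Om : set 'rV[R]_d) (f : vfield d) : Prop :=
  (iintE (fun x => ((\1_Om x : R) * \sum_i f x ord0 i ^+ 2)%:E) < +oo)%E.

(* partial derivative d v_i / d x_k at x (classical; a.e. = weak derivative
   for continuous piecewise polynomials) *)
Definition pd d (v : vfield d) (i k : 'I_d) (x : 'rV[R]_d) : R :=
  derive (fun y : 'rV[R]_d => v y ord0 i) x (delta_mx ord0 k).
Definition divg d (v : vfield d) (x : 'rV[R]_d) : R := \sum_i pd v i i x.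

Definition ipgrad d (Om : set 'rV[R]_d) (v w : vfield d) : R :=
  intOm Om (fun x => \sum_i \sum_k pd v i k x * pd w i k x).
Definition ipdiv d (Om : set 'rV[R]_d) (v w : vfield d) : R :=
  intOm Om (fun x => divg v x * divg w x).
Definition gradnorm d (Om : set 'rV[R]_d) (v : vfield d) : R := Num.sqrt (ipgrad Om v v).
Definition divnorm d (Om : set 'rV[R]_d) (v : vfield d) : R := Num.sqrt (ipdiv Om v v).

Definition closed_simplex d (p : 'I_d.+1 -> 'rV[R]_d) : set 'rV[R]_d :=
  [set x | exists l : 'I_d.+1 -> R,
     [/\ forall k, 0 <= l k, \sum_k l k = 1 & x = \sum_k l k *: p k]].
Definition open_simplex d (p : 'I_d.+1 -> 'rV[R]_d) : set 'rV[R]_d :=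
  [set x | exists l : 'I_d.+1 -> R,
     [/\ forall k, 0 < l k, \sum_k l k = 1 & x = \sum_k l k *: p k]].
Definition nondegenerate d (p : 'I_d.+1 -> 'rV[R]_d) : Prop :=
  \det (\matrix_(i < d, j < d) (p (lift ord0 i) ord0 j - p ord0 ord0 j)) != 0.

Definition polyhedral_domain d (Om : set 'rV[R]_d) : Prop :=
  [/\ open Om, connected Om, Om !=set0 &
      exists (M : nat) (T : 'I_M -> 'I_d.+1 -> 'rV[R]_d),
        (forall m, nondegenerate (T m)) /\
        Om = interior (\bigcup_(m in [set: 'I_M]) closed_simplex (T m))].

Definition mesh d (Om : set 'rV[R]_d) (h : R) (M : nat)
  (T : 'I_M -> 'I_d.+1 -> 'rV[R]_d) : Prop :=
  [/\ forall m, nondegenerate (T m),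
      forall m m', m != m' -> open_simplex (T m) `&` open_simplex (T m') = set0,
      closure Om = \bigcup_(m in [set: 'I_M]) closed_simplex (T m) &
      forall m k k', enorm (T m k - T m k') <= h].

Definition is_polyfun d (g : 'rV[R]_d -> R) : Prop :=
  exists (k : nat) (c : {ffun 'I_d -> 'I_k.+1} -> R),
    forall x, g x = \sum_(a : {ffun 'I_d -> 'I_k.+1}) c a * \prod_i x ord0 i ^+ a i.

Definition FE_basis d (Om : set 'rV[R]_d) (h : R) (N : nat)
  (phi : 'I_N -> vfield d) : Prop :=
  exists (M : nat) (T : 'I_M -> 'I_d.+1 -> 'rV[R]_d),
    [/\ mesh Om h T,
        forall i, continuous (phi i),
        forall i x, ~ (closure Om) x -> phi i x = 0,
        forall i x, (closure Om `\` Om) x -> phi i x = 0 &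
        forall i m (j : 'I_d), exists g, is_polyfun g /\
          forall x, open_simplex (T m) x -> phi i x ord0 j = g x].

Definition combo d N (phi : 'I_N -> vfield d) (a : 'cV[R]_N) : vfield d :=
  fun x => \sum_i a i ord0 *: phi i x.

Definition penalty_matrix d (Om : set 'rV[R]_d) N (phi : 'I_N -> vfield d) (eps : R)
  : 'M[R]_N :=
  \matrix_(i, j) (ipgrad Om (phi i) (phi j) + eps^-1 * ipdiv Om (phi i) (phi j)).

Definition penalty_sol d (Om : set 'rV[R]_d) N (phi : 'I_N -> vfield d) (eps : R)
  (f : vfield d) (c : 'cV[R]_N) : Prop :=
  forall a : 'cV[R]_N,
    ipgrad Om (combo phi c) (combo phi a) + eps^-1 * ipdiv Om (combo phi c) (combo phi a)
    = ip Om f (combo phi a).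

Definition L2proj d (Om : set 'rV[R]_d) N (phi : 'I_N -> vfield d)
  (f : vfield d) (g : 'cV[R]_N) : Prop :=
  forall a : 'cV[R]_N, ip Om (combo phi g) (combo phi a) = ip Om f (combo phi a).

End FEdefs.

(* Main.v *)
Require Import Defs.
From HB Require Import structures.
From mathcomp Require Import all_boot all_order all_algebra.
From mathcomp Require Import all_classical all_reals all_analysis.
From mathcomp Require Import measurable_realfun ring lra.
Import Order.TTheory GRing.Theory Num.Theory.
Import numFieldNormedType.Exports.
Local Open Scope classical_set_scope.
Local Open Scope ring_scope.
Set Implicit Arguments.
Unset Strict Implicit.
Unset Printing Implicit Defensive.

(** In coordinates the penalty matrix is [A = G + eps^-1 D], where [Mm], [G] and
[D] are the Gram matrices of the basis for [(u, v)], [(grad u, grad v)] and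
[(div u, div v)].  The Poincare inequality and (A2) give
[a^T A a >= c |a|^2 / N], hence [|A^-1| <= C N]; the inverse estimate with (A2)
gives [|A| <= C (1 + eps^-1) h^-2 / N], and the same way [|A c|] is bounded by
[C N^(-1/2) (h^-2 |u| + eps^-1 h^-1 |div u|)].  As [A c = Mm g], where [g] is the
coefficient vector of the projection of [f], also [|A c| <= C N^(-1/2) |f^h|].
The maximum is attained since [Mm] is invertible: every [c], in particular a
maximizer of [|A c| / |c|], solves the problem for the datum with coefficient
vector [Mm^-1 A c].

The integrals are iterated one-variable integrals, and the classical partial
derivatives of a piecewise polynomial are junk on the faces of the mesh.  Both
are dealt with by replacing each integrand by a bounded, jointly measurable
function that agrees with it off the hyperplanes carrying the faces: at each
stage of the iteration all but countably many slices of a hyperplane are proper.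
*)

(** * Iterated integrals of bounded jointly measurable functions *)

Section IteratedIntegral.
Context {R : realType}.
Local Notation mu := (@lebesgue_measure R).

(** The same term as the argument of [g] in [iint] and [iintE], so that their slices are [vcons]
    slices by conversion. *)
Definition vcons {n : nat} (x : R) (y : 'rV[R]_n) : 'rV[R]_n.+1 :=
  row_mx (\row_(_ < 1) x) y.

Lemma vcons0 n x (y : 'rV[R]_n) : vcons x y ord0 ord0 = x.
Proof.
have -> : ord0 = lshift n (@ord0 0) by exact: val_inj.
by apply: etrans (row_mxEl _ _ _ _) _; rewrite mxE.
Qed.

Lemma vconsS n x (y : 'rV[R]_n) i : vcons x y ord0 (lift ord0 i) = y ord0 i.
Proof.
have -> : lift ord0 i = rshift 1 i by exact: val_inj.
exact: row_mxEr.
Qed.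

(* Measurability of [(t, x_0, .., x_{n-1}) |-> G t (x_0, .., x_{n-1})] for the nested
   product of [T] with [n] copies of the line; row vectors carry no sigma-algebra here. *)
Fixpoint jmeas (n : nat) :
    forall d (T : measurableType d), (T -> 'rV[R]_n -> R) -> Prop :=
  match n with
  | 0 => fun d T G => measurable_fun [set: T] (fun t => G t 0)
  | n'.+1 => fun d T G => @jmeas n' _ (T * measurableTypeR R)%type
                            (fun tx y => G tx.1 (vcons tx.2 y))
  end.
Arguments jmeas {n d T} _.

Lemma jmeas_cst n d (T : measurableType d) (g : T -> R) :
  measurable_fun setT g -> jmeas (fun t (_ : 'rV[R]_n) => g t).
Proof.
elim: n d T g => [|n IH] d T g mg //=; apply: IH.
exact: measurableT_comp.
Qed.

(** The operation is a parameter so that one induction serves sums, products and the indicator of a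
    strict inequality. *)
Lemma jmeas_op2 (op : R -> R -> R) :
  (forall d (T : measurableType d) (f g : T -> R), measurable_fun setT f ->
     measurable_fun setT g -> measurable_fun setT (fun t => op (f t) (g t))) ->
  forall n d (T : measurableType d) (F G : T -> 'rV[R]_n -> R),
  jmeas F -> jmeas G -> jmeas (fun t y => op (F t y) (G t y)).
Proof.
move=> hop; elim=> [|n IH] d T F G mF mG /=; first exact: hop.
exact: (IH _ _ (fun (tx : T * measurableTypeR R) y => F tx.1 (vcons tx.2 y))
               (fun (tx : T * measurableTypeR R) y => G tx.1 (vcons tx.2 y))).
Qed.

Lemma jmeas_coord n d (T : measurableType d) (i : 'I_n) :
  jmeas (fun (_ : T) (y : 'rV[R]_n) => y ord0 i).
Proof.
elim: n d T i => [|n IH] d T i; first by case: i.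
case: (unliftP ord0 i) => [j ->|->] /=.
  under eq_fun do under eq_fun do rewrite vconsS.
  exact: IH.
under eq_fun do under eq_fun do rewrite vcons0.
by apply: jmeas_cst; exact: measurable_snd.
Qed.

(** Taking [h] constant freezes the parameter; this is how slices of jointly measurable functions
    stay jointly measurable. *)
Lemma jmeas_comp n d d' (T : measurableType d) (U : measurableType d')
    (h : U -> T) (G : T -> 'rV[R]_n -> R) :
  measurable_fun setT h -> jmeas G -> jmeas (fun u => G (h u)).
Proof.
elim: n d d' T U h G => [|n IH] d d' T U h G mh /= mG.
  exact: (measurableT_comp mG mh).
apply: (IH _ _ _ _ (fun ux : U * measurableTypeR R => (h ux.1, ux.2))) mG.
apply: measurable_fun_pair => //; exact: measurableT_comp.
Qed.

(** Tonelli's theorem gives measurability of the partial integrals of nonnegative functions; it is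
    applied to the positive and negative parts, and [fine] is measurable. *)
Lemma measurable_Rintegral2 d (T : measurableType d)
    (f : T * measurableTypeR R -> R) :
  measurable_fun setT f ->
  measurable_fun setT (fun t => Rintegral mu setT (fun x => f (t, x))).
Proof.
move=> mf.
have mE : measurable_fun setT (EFin \o f) by exact/measurable_EFinP.
pose F t : \bar R := (\int[mu]_x (f (t, x))%:E)%E.
suff mF : measurable_fun setT F.
  exact: measurableT_comp (measurable_realfun.fine_measurable measurableT) mF.
rewrite /F; under eq_fun do rewrite integralE.
apply: emeasurable_funB.
- have := @measurable_fun_fubini_tonelli_F _ _ T _ R mu (EFin \o f)^\+%E
    (measurable_funepos mE) (funepos_ge0 _).
  apply: eq_measurable_fun => x _; apply: eq_integral => y _.
  by rewrite !funeposE.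
- have := @measurable_fun_fubini_tonelli_F _ _ T _ R mu (EFin \o f)^\-%E
    (measurable_funeneg mE) (funeneg_ge0 _).
  apply: eq_measurable_fun => x _; apply: eq_integral => y _.
  by rewrite !funenegE.
Qed.

Lemma measurable_iint n d (T : measurableType d) (G : T -> 'rV[R]_n -> R) :
  jmeas G -> measurable_fun setT (fun t => iint (G t)).
Proof.
elim: n d T G => [|n IH] d T G mG //=.
exact: measurable_Rintegral2 (IH _ _ _ mG).
Qed.

Lemma measurable_iint_vcons n (g : 'rV[R]_n.+1 -> R) :
  jmeas (fun _ : unit => g) ->
  measurable_fun setT (fun x => iint (fun y => g (vcons x y))).
Proof.
move=> mg.
have mg' : jmeas (fun (tx : unit * measurableTypeR R) y => g (vcons tx.2 y)).
  exact: mg.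
exact: (measurable_fun_pair2 tt (measurable_iint mg')).
Qed.

Lemma box_integrable (F : R -> R) (B L : R) : measurable_fun setT F ->
  0 <= B -> (forall x, `|F x| <= B) -> (forall x, F x != 0 -> `|x| <= L) ->
  mu.-integrable setT (EFin \o F).
Proof.
move=> mF B0 FB Fs.
have iI := @integrable_indic_itv R (- L) L true false.
have iB := @integrableZl _ _ _ mu setT measurableT B _ iI.
apply: (le_integrable measurableT _ _ iB); first exact/measurable_EFinP.
move=> x _ /=; rewrite lee_fin normrM (ger0_norm B0).
have [->|F0] := eqVneq (F x) 0; first by rewrite normr0 mulr_ge0.
rewrite indicE mem_set ?normr1 ?mulr1//.
by rewrite /= in_itv /= -ler_norml Fs.
Qed.

Lemma box_integral_bound (F : R -> R) (B L : R) : measurable_fun setT F ->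
  0 <= B -> 0 <= L -> (forall x, `|F x| <= B) ->
  (forall x, F x != 0 -> `|x| <= L) ->
  `|Rintegral mu setT F| <= B * (2 * L).
Proof.
move=> mF B0 L0 FB Fs.
have iF := box_integrable mF B0 FB Fs.
apply: (le_trans (le_normr_Rintegral measurableT iF)).
pose I := [set` Interval (BSide true (- L)) (BSide false L)].
have <- : Rintegral mu setT (fun x => B * \1_I x) = B * (2 * L).
  rewrite RintegralZl //; last exact: integrable_indic_itv.
  congr (_ * _); rewrite /Rintegral integral_indic ?setIT; last 2 first.
  - exact: measurableT.
  - exact: measurable_itv.
  have muI : mu I = _ := @lebesgue_measure_itv R `[- L, L].
  apply: etrans (congr1 fine muI) _; rewrite /= lte_fin.
  case: ltP => [_|h] /=; [lra|]; have -> : L = 0 by lra.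
  by rewrite mulr0.
apply: le_Rintegral => //.
- apply: (@box_integrable _ B L) => //; first exact: measurableT_comp.
  + by move=> x; rewrite normr_id.
  + by move=> x; rewrite normr_eq0; exact: Fs.
- have := @integrable_indic_itv R (- L) L true false.
  exact: (@integrableZl _ _ _ mu setT measurableT B).
- move=> x _; have [->|F0] := eqVneq (F x) 0.
    by rewrite normr0 mulr_ge0.
  rewrite indicE mem_set ?mulr1//.
  by rewrite /I /= in_itv /= -ler_norml Fs.
Qed.

(** The class in which iterated integrals behave well: it is stable under slicing, and the bound
    together with the box makes every one-variable stage integrable. *)
Definition good (L : R) {n} (g : 'rV[R]_n -> R) :=
  [/\ jmeas (fun _ : unit => g),
      exists K, forall y, `|g y| <= K
    & forall y, g y != 0 -> forall i, `|y ord0 i| <= L].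

Lemma good_vcons L n (g : 'rV[R]_n.+1 -> R) x :
  good L g -> good L (fun y => g (vcons x y)).
Proof.
move=> [mg [K gK] gs]; split.
- apply: (jmeas_comp (h := fun _ : unit => (tt, x : measurableTypeR R)) _ mg).
  exact: measurable_cst.
- by exists K => y.
- by move=> y /gs h i; have := h (lift ord0 i); rewrite vconsS.
Qed.

Lemma iint0 n : iint (fun _ : 'rV[R]_n => 0) = 0 :> R.
Proof.
elim: n => //= n IH; under eq_Rintegral do rewrite IH.
by rewrite Rintegral_cst// mul0r.
Qed.

Lemma iint_bound L K n (g : 'rV[R]_n -> R) : 0 <= L -> 0 <= K ->
  good L g -> (forall y, `|g y| <= K) -> `|iint g| <= K * (2 * L) ^+ n.
Proof.
move=> L0 K0; elim: n g => [|n IH] g gg gK; first by rewrite /= expr0 mulr1.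
rewrite exprSr mulrA; apply: box_integral_bound => //.
- by case: gg => mg _ _; exact: measurable_iint_vcons.
- by rewrite mulr_ge0// exprn_ge0// mulr_ge0.
- by move=> x; apply: IH => //; exact: good_vcons.
- move=> x; apply: contraNT => xL; apply/eqP.
  rewrite -[RHS](iint0 n); congr iint; apply/funext => y.
  apply/eqP; apply: contraNT xL; case: gg => _ _ gs /gs /(_ ord0).
  by rewrite -/(vcons x y) vcons0.
Qed.

Lemma integrable_iint L n (g : 'rV[R]_n.+1 -> R) : 0 <= L -> good L g ->
  mu.-integrable setT (EFin \o (fun x => iint (fun y => g (vcons x y)))).
Proof.
move=> L0 gg; have [mg [K gK] gs] := gg.
have K0 : 0 <= K by apply: le_trans (gK 0).
apply: (@box_integrable _ (K * (2 * L) ^+ n) L).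
- exact: measurable_iint_vcons.
- by rewrite mulr_ge0// exprn_ge0// mulr_ge0.
- by move=> x; apply: iint_bound => //; exact: good_vcons.
- move=> x; apply: contraNT => xL; apply/eqP.
  rewrite -[RHS](iint0 n); congr iint; apply/funext => y.
  apply/eqP; apply: contraNT xL => /gs /(_ ord0).
  by rewrite vcons0.
Qed.

(** By [integrable_iint] the inner iterated integrals are integrable in the outer variable, so
    one-variable linearity applies at each stage. *)
Lemma iint_lin L n (a : R) (g h : 'rV[R]_n -> R) : 0 <= L ->
  good L g -> good L h ->
  iint (fun y => a * g y + h y) = a * iint g + iint h.
Proof.
move=> L0; elim: n g h => [|n IH] g h gg gh //=.
under eq_Rintegral do rewrite (IH _ _ (good_vcons _ gg) (good_vcons _ gh)).
have ig := integrable_iint L0 gg.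
have ih := integrable_iint L0 gh.
rewrite RintegralD//; first by rewrite RintegralZl.
exact: (@integrableZl _ _ _ mu setT measurableT a _ ig).
Qed.

Lemma iint_ge0 n (g : 'rV[R]_n -> R) : (forall y, 0 <= g y) -> 0 <= iint g.
Proof.
elim: n g => [|n IH] g g0 //=; apply: Rintegral_ge0 => x _; exact: IH.
Qed.

(* An iterated form of [P] almost everywhere that is stable under slicing. *)
Fixpoint aev (n : nat) : ('rV[R]_n -> Prop) -> Prop :=
  match n with
  | 0 => fun P => P 0
  | n'.+1 => fun P => exists S : set R, countable S /\
      forall x, ~ S x -> @aev n' (fun y => P (vcons x y))
  end.
Arguments aev {n}.

Lemma aevT n (P : 'rV[R]_n -> Prop) : (forall y, P y) -> aev P.
Proof.
elim: n P => [|n IH] P h /=; first exact: h.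
by exists set0; split => [|x _]; [exact: countable0|exact: IH].
Qed.

Lemma aev_imp n (P Q : 'rV[R]_n -> Prop) : (forall y, P y -> Q y) ->
  aev P -> aev Q.
Proof.
elim: n P Q => [|n IH] P Q h /=; first exact: h.
move=> [S [cS hS]]; exists S; split=> // x /hS; apply: IH => y; exact: h.
Qed.

Lemma countable_setU (T : Type) (A B : set T) :
  countable A -> countable B -> countable (A `|` B).
Proof.
move=> cA cB.
have -> : A `|` B = \bigcup_(b in [set: bool]) (if b then A else B).
  apply/seteqP; split=> [x [Ax|Bx]|x [[] _ h]].
  - by exists true.
  - by exists false.
  - by left.
  - by right.
by apply: bigcup_countable => [|[]//]; exact: countableP.
Qed.

Lemma aev_and n (P Q : 'rV[R]_n -> Prop) :
  aev P -> aev Q -> aev (fun y => P y /\ Q y).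
Proof.
elim: n P Q => [|n IH] P Q //= [S [cS hS]] [S' [cS' hS']].
exists (S `|` S'); split; first exact: countable_setU.
by move=> x /not_orP[/hS ? /hS' ?]; exact: IH.
Qed.

Lemma aev_forall n (I : finType) (P : I -> 'rV[R]_n -> Prop) :
  (forall i, aev (P i)) -> aev (fun y => forall i, P i y).
Proof.
move=> hP.
suff : aev (fun y => forall i, i \in enum I -> P i y).
  by apply: aev_imp => y h i; apply: h; rewrite mem_enum.
elim: (enum I) => [|i s IH]; first exact: aevT.
apply: aev_imp (aev_and (hP i) IH) => y [h1 h2] j.
by rewrite inE => /orP[/eqP->//|/h2].
Qed.

(** The function [f] is itself measurable: off [S] it is [g], and within the countable set [S] every
    preimage is countable. As [S] is a null set, the integrals agree. *)
Lemma integral_countable_modif (f g : R -> \bar R) (S : set R) : countable S ->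
  measurable_fun setT g -> (forall x, ~ S x -> f x = g x) ->
  (\int[mu]_x f x = \int[mu]_x g x)%E.
Proof.
move=> cS mg fg.
have mS : measurable (S : set (measurableTypeR R)).
  by apply: countable_measurable => // t; exact: measurable_set1.
apply: (@ae_eq_integral _ _ _ mu setT) => //.
- rewrite -(setvU S); apply/measurable_funU => //; first exact: measurableC.
  split.
    apply/(measurable_fun_eqP g); last exact: measurable_funTS.
    by move=> x; rewrite inE => /fg.
  move=> _ Y mY; apply: countable_measurable.
    by move=> t; exact: measurable_set1.
  by apply: sub_countable cS; apply: subset_card_le; exact: subIsetl.
- exists S; split => //; first exact: countable_lebesgue_measure0.
  by move=> x /= h; apply: contrapT => nS; apply: h => _; exact: fg.
Qed.

(** At each stage the outer integrand changes only on a countable set of slices; on the others the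
    induction hypothesis applies. *)
Lemma iint_aev L n (f g : 'rV[R]_n -> R) : 0 <= L -> good L g ->
  aev (fun y => f y = g y) -> iint f = iint g.
Proof.
move=> L0; elim: n f g => [|n IH] f g gg //= [S [cS hS]].
congr fine; apply: (@integral_countable_modif _ _ S) => //.
- by have /integrableP[] := integrable_iint L0 gg.
- move=> x nS; congr (_%:E); apply: IH; last exact: hS.
  exact: good_vcons.
Qed.

(** The extended-valued counterpart of [iint_aev]; its real right-hand side yields the finiteness
    asked for by [L2vec]. *)
Lemma iintE_aev L n (f : 'rV[R]_n -> \bar R) (g : 'rV[R]_n -> R) :
  0 <= L -> good L g ->
  aev (fun y => f y = (g y)%:E) -> iintE f = (iint g)%:E.
Proof.
move=> L0; elim: n f g => [|n IH] f g gg //= [S [cS hS]].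
have ig := integrable_iint L0 gg.
rewrite fineK; last exact: integrable_fin_num.
apply: (@integral_countable_modif _ _ S) => //.
- by have /integrableP[] := ig.
- move=> x nS; apply: IH; last exact: hS.
  exact: good_vcons.
Qed.

End IteratedIntegral.
Arguments jmeas {R n d T} _.
Arguments aev {R n} _.

(** * Polynomial functions and simplices *)

Section PiecewisePolynomials.
Context {R : realType}.

(** Polynomial functions generated inductively instead of by coefficients, so that measurability,
    bounds, continuity and derivatives follow by induction on the construction. *)
Inductive polyc d : ('rV[R]_d -> R) -> Prop :=
| polyc_cst c : polyc (fun _ => c)
| polyc_coord i : polyc (fun x => x ord0 i)
| polyc_add p q : polyc p -> polyc q -> polyc (fun x => p x + q x)
| polyc_mul p q : polyc p -> polyc q -> polyc (fun x => p x * q x).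

Lemma polyc_sum d (I : Type) (r : seq I) (P : pred I) (p : I -> 'rV[R]_d -> R) :
  (forall i, polyc (p i)) -> polyc (fun x => \sum_(i <- r | P i) p i x).
Proof.
move=> hp; elim: r => [|i r IH].
  by under eq_fun do rewrite big_nil; exact: polyc_cst.
under eq_fun do rewrite big_cons.
by case: (P i) => //; exact: polyc_add.
Qed.

Lemma polyc_prod d (I : Type) (r : seq I) (P : pred I) (p : I -> 'rV[R]_d -> R) :
  (forall i, polyc (p i)) -> polyc (fun x => \prod_(i <- r | P i) p i x).
Proof.
move=> hp; elim: r => [|i r IH].
  by under eq_fun do rewrite big_nil; exact: polyc_cst.
under eq_fun do rewrite big_cons.
by case: (P i) => //; exact: polyc_mul.
Qed.

Lemma polyc_exp d (p : 'rV[R]_d -> R) n : polyc p -> polyc (fun x => p x ^+ n).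
Proof.
move=> hp; elim: n => [|n IH].
  by under eq_fun do rewrite expr0; exact: polyc_cst.
by under eq_fun do rewrite exprS; exact: polyc_mul.
Qed.

Lemma is_polyfun_polyc d (g : 'rV[R]_d -> R) : is_polyfun g -> polyc g.
Proof.
move=> [k [c hg]]; rewrite (funext hg).
apply: polyc_sum => a; apply: polyc_mul; first exact: polyc_cst.
by apply: polyc_prod => i; apply: polyc_exp; exact: polyc_coord.
Qed.

Lemma jmeasD n d (T : measurableType d) (F G : T -> 'rV[R]_n -> R) :
  jmeas F -> jmeas G -> jmeas (fun t y => F t y + G t y).
Proof. by apply: jmeas_op2 => *; exact: measurable_funD. Qed.

Lemma jmeasM n d (T : measurableType d) (F G : T -> 'rV[R]_n -> R) :
  jmeas F -> jmeas G -> jmeas (fun t y => F t y * G t y).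
Proof. by apply: jmeas_op2 => *; exact: measurable_funM. Qed.

Lemma jmeas_lt n d (T : measurableType d) (F G : T -> 'rV[R]_n -> R) :
  jmeas F -> jmeas G -> jmeas (fun t y => (F t y < G t y)%R%:R : R).
Proof.
apply: (@jmeas_op2 R (fun a b => (a < b)%R%:R)) => d' U f g mf mg.
have := @measurable_fun_ifT _ _ U R (fun=> 1) (fun=> 0) (fun t => f t < g t).
rewrite (_ : (fun t => if f t < g t then 1 else 0) =
  (fun t => (f t < g t)%R%:R)); last by apply/funext => t; case: (f t < g t).
by apply; [exact: measurable_fun_ltr|exact: measurable_cst|exact: measurable_cst].
Qed.

Lemma polyc_jmeas n d (T : measurableType d) (p : 'rV[R]_n -> R) :
  polyc p -> jmeas (fun _ : T => p).
Proof.
elim=> [c|i|{}p q _ hp _ hq|{}p q _ hp _ hq].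
- by apply: jmeas_cst; exact: measurable_cst.
- exact: jmeas_coord.
- exact: jmeasD.
- exact: jmeasM.
Qed.

Lemma polyc_bounded n (p : 'rV[R]_n -> R) (L : R) : polyc p ->
  exists K : R, 0 <= K /\ forall x : 'rV[R]_n, (forall i, `|x ord0 i| <= L) -> `|p x| <= K.
Proof.
elim=> [c|i|{}p q _ [K [K0 hp]] _ [K' [K0' hq]]|{}p q _ [K [K0 hp]] _ [K' [K0' hq]]].
- by exists `|c|.
- exists `|L|; split => // x /(_ i) h; apply: (le_trans h); exact: ler_norm.
- exists (K + K'); split; first exact: addr_ge0.
  by move=> x h; apply: (le_trans (ler_normD _ _)); apply: lerD; [exact: hp|exact: hq].
- exists (K * K'); split; first exact: mulr_ge0.
  by move=> x h; rewrite normrM ler_pM//; [exact: hp|exact: hq].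
Qed.

Lemma polyc_continuous n (p : 'rV[R]_n -> R) : polyc p -> continuous p.
Proof.
elim=> [c|i|{}p q _ hp _ hq|{}p q _ hp _ hq] x.
- exact: cst_continuous.
- exact: coord_continuous.
- exact: continuousD (hp x) (hq x).
- exact: continuousM (hp x) (hq x).
Qed.

Lemma is_derive_coord n (i : 'I_n) (x v : 'rV[R]_n) :
  is_derive x v (fun y : 'rV[R]_n => y ord0 i) (v ord0 i).
Proof.
have h : derivable (id : 'rV[R]_n -> 'rV[R]_n) x v by exact: derivable_id.
apply: DeriveDef; first exact: (proj1 (derivable_mxP _ _ _) h ord0 i).
have := derive_mx h; rewrite derive_id => /matrixP /(_ ord0 i).
by rewrite mxE.
Qed.

Lemma polyc_derive n (p : 'rV[R]_n -> R) (v : 'rV[R]_n) : polyc p ->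
  exists2 q, polyc q & forall x, is_derive x v p (q x).
Proof.
elim=> [c|i|{}p q pp [p' pp' hp] pq [q' pq' hq]|{}p q pp [p' pp' hp] pq [q' pq' hq]].
- exists (fun _ => 0); first exact: polyc_cst.
  by move=> x; exact: is_derive_cst.
- exists (fun _ => v ord0 i); first exact: polyc_cst.
  by move=> x; exact: is_derive_coord.
- exists (fun x => p' x + q' x); first exact: polyc_add.
  by move=> x; exact: is_deriveD (hp x) (hq x).
- exists (fun x => p x * q' x + q x * p' x).
    by apply: polyc_add; exact: polyc_mul.
  by move=> x; exact: is_deriveM (hp x) (hq x).
Qed.

(* Two distinct slices on which an affine function vanishes force it to vanish everywhere. *)
Lemma countable_affine_slice n (a : R) (b : 'I_n.+1 -> R) :
  (exists x : 'rV[R]_n.+1, a + \sum_i x ord0 i * b i != 0) ->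
  countable [set x | forall y : 'rV[R]_n,
    a + x * b ord0 + \sum_i y ord0 i * b (lift ord0 i) = 0].
Proof.
move=> [z hz].
pose f x (y : 'rV[R]_n) := a + x * b ord0 + \sum_i y ord0 i * b (lift ord0 i).
pose y : 'rV[R]_n := \row_i z ord0 (lift ord0 i).
have zE : a + \sum_i z ord0 i * b i = f (z ord0 ord0) y.
  rewrite big_ord_recl addrA /f; congr (_ + _).
  by apply: eq_bigr => i _; rewrite mxE.
have uniq x x' : (forall y, f x y = 0) -> (forall y, f x' y = 0) -> x = x'.
  move=> hx hx'; apply/eqP; apply: contraNT hz => xx'.
  have b0 : b ord0 = 0.
    have : (x - x') * b ord0 = 0.
      rewrite (_ : _ * _ = f x y - f x' y); last by rewrite /f; ring.
      by rewrite hx hx' subrr.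
    by move/eqP; rewrite mulf_eq0 subr_eq0 (negbTE xx') => /eqP.
  by rewrite zE -(hx y) /f b0 !mulr0.
have [[x hx]|h] := pselect (exists x, forall y, f x y = 0).
  rewrite (_ : mkset _ = [set x]); first exact: countable1.
  by apply/seteqP; split => [x' hx'|x' ->//]; exact: uniq.
rewrite (_ : mkset _ = set0); first exact: countable0.
by apply/seteqP; split => // x hx; apply: h; exists x.
Qed.

(** By [countable_affine_slice], all but countably many slices of an affine function that is not
    identically zero are again not identically zero, so the induction continues. *)
Lemma aev_affine n (a : R) (b : 'I_n -> R) :
  (exists x : 'rV[R]_n, a + \sum_i x ord0 i * b i != 0) ->
  aev (fun x : 'rV[R]_n => a + \sum_i x ord0 i * b i != 0).
Proof.
elim: n a b => [|n IH] a b hz /=.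
  by case: hz => z; rewrite !big_ord0.
have cS := countable_affine_slice hz; eexists; split; first exact: cS.
move=> x /existsNP[y /eqP hy].
have := IH (a + x * b ord0) (fun i => b (lift ord0 i)) (ex_intro _ y hy).
apply: aev_imp => u; rewrite big_ord_recl vcons0 addrA.
by under [in X in _ -> X]eq_bigr do rewrite vconsS.
Qed.

End PiecewisePolynomials.

(** * Barycentric coordinates of a nondegenerate simplex *)

Section Simplex.
Context {R : realType}.
Variables (d : nat) (p : 'I_d.+1 -> 'rV[R]_d).
Hypothesis ndp : Defs.nondegenerate p.

Let B : 'M[R]_d := \matrix_(i, j) (p (lift ord0 i) ord0 j - p ord0 ord0 j).

Let B_unit : B \in unitmx.
Proof. by rewrite unitmxE unitfE. Qed.

(** Barycentric coordinates: the rows of [B] are the edges issuing from vertex 0, the coordinates of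
    [x - p ord0] in this basis belong to the other vertices, and vertex 0 receives what is missing
    to 1. *)
Definition bary (k : 'I_d.+1) (x : 'rV[R]_d) : R :=
  if unlift ord0 k is Some i then ((x - p ord0) *m invmx B) ord0 i
  else 1 - \sum_i ((x - p ord0) *m invmx B) ord0 i.

Lemma baryS i x : bary (lift ord0 i) x = ((x - p ord0) *m invmx B) ord0 i.
Proof. by rewrite /bary liftK. Qed.

Lemma bary0 x : bary ord0 x = 1 - \sum_i bary (lift ord0 i) x.
Proof.
by rewrite {1}/bary unlift_none; congr (_ - _); apply: eq_bigr => i _; rewrite baryS.
Qed.

Lemma sum_bary x : \sum_k bary k x = 1.
Proof. by rewrite big_ord_recl bary0 subrK. Qed.

Lemma rowB i : row i B = p (lift ord0 i) - p ord0.
Proof. by apply/rowP => j; rewrite !mxE. Qed.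

Lemma bary_comb x : x = \sum_k bary k x *: p k.
Proof.
rewrite big_ord_recl bary0 scalerBl scale1r scaler_suml.
rewrite -addrA [X in _ + X]addrC -sumrB.
under eq_bigr do rewrite -scalerBr -rowB baryS.
by rewrite -mulmx_sum_row mulmxKV// addrC subrK.
Qed.

(** Invertibility of [B] makes the weights unique, which turns the existential definitions of the
    simplices into sign conditions on [bary]. *)
Lemma bary_uniq (l : 'I_d.+1 -> R) k :
  \sum_i l i = 1 -> bary k (\sum_i l i *: p i) = l k.
Proof.
move=> l1.
have l0 : l ord0 = 1 - \sum_i l (lift ord0 i) by rewrite -l1 big_ord_recl addrK.
have h : (\sum_i l i *: p i - p ord0) *m invmx B = \row_i l (lift ord0 i).
  rewrite big_ord_recl l0 scalerBl scale1r scaler_suml.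
  rewrite addrAC (addrAC (p ord0)) subrr sub0r addrC -sumrB.
  have -> : \sum_i (l (lift ord0 i) *: p (lift ord0 i) - l (lift ord0 i) *: p ord0)
    = (\row_i l (lift ord0 i)) *m B.
    rewrite mulmx_sum_row; apply: eq_bigr => i _.
    by rewrite -scalerBr rowB mxE.
  by rewrite mulmxK.
have hS i : bary (lift ord0 i) (\sum_i l i *: p i) = l (lift ord0 i).
  by rewrite baryS h mxE.
case: (unliftP ord0 k) => [j ->|->]; first exact: hS.
by rewrite bary0 l0; congr (_ - _); apply: eq_bigr => i _; exact: hS.
Qed.

Lemma bary_vertex k : bary k (p k) = 1.
Proof.
have := @bary_uniq (fun i => (i == k)%:R) k.
rewrite eqxx (bigD1 k)//= eqxx big1 ?addr0 => [/(_ erefl)|i /negbTE->//].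
rewrite (bigD1 k)//= eqxx scale1r big1 ?addr0// => i /negbTE->.
by rewrite scale0r.
Qed.

Lemma open_simplexE x : open_simplex p x <-> forall k, 0 < bary k x.
Proof.
split=> [[l [l0 l1 ->]] k|h]; first by rewrite bary_uniq.
by exists (bary^~ x); split => //; [exact: sum_bary|exact: bary_comb].
Qed.

Lemma closed_simplexE x : closed_simplex p x <-> forall k, 0 <= bary k x.
Proof.
split=> [[l [l0 l1 ->]] k|h]; first by rewrite bary_uniq.
by exists (bary^~ x); split => //; [exact: sum_bary|exact: bary_comb].
Qed.

Lemma bary_affine k : exists (a : R) (b : 'I_d -> R),
  forall x, bary k x = a + \sum_i x ord0 i * b i.
Proof.
have hS i : exists (a : R) (b : 'I_d -> R),
    forall x, bary (lift ord0 i) x = a + \sum_i x ord0 i * b i.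
  exists (- (p ord0 *m invmx B) ord0 i), (fun j => invmx B j i) => x.
  by rewrite baryS mulmxBl !mxE addrC.
case: (unliftP ord0 k) => [j ->//|->].
have /choice[a /choice[b hab]] := hS.
exists (1 - \sum_i a i), (fun j => - \sum_i b i j) => x.
rewrite bary0; under eq_bigr do rewrite hab.
rewrite big_split /= opprD addrA; congr (_ + _).
rewrite exchange_big /= -sumrN; apply: eq_bigr => j _.
by rewrite -mulr_sumr mulrN.
Qed.

Lemma bary_polyc k : polyc (bary k).
Proof.
have [a [b hab]] := bary_affine k; rewrite (funext hab).
apply: polyc_add; first exact: polyc_cst.
apply: polyc_sum => i; apply: polyc_mul; first exact: polyc_coord.
exact: polyc_cst.
Qed.

(** The affine function [bary k] is not identically zero, because it equals 1 at vertex [k]. *)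
Lemma aev_bary k : aev (fun x => bary k x != 0).
Proof.
have [a [b hab]] := bary_affine k.
have : aev (fun x => a + \sum_i x ord0 i * b i != 0).
  by apply: aev_affine; exists (p k); rewrite -hab bary_vertex oner_neq0.
by apply: aev_imp => x; rewrite hab.
Qed.

Lemma closed_simplex_closed : closed (closed_simplex p).
Proof.
rewrite (_ : closed_simplex p = \bigcap_(k in [set: 'I_d.+1]) [set x | 0 <= bary k x]).
  apply: closed_bigI => k _.
  apply: (@closed_comp _ _ (bary k) [set y | 0 <= y]); last exact: closed_ge.
  by move=> x _; apply: polyc_continuous; exact: bary_polyc.
apply/seteqP; split => x.
  by move/closed_simplexE => h k _; exact: h.
by move=> h; apply/closed_simplexE => k; exact: h.
Qed.

Lemma open_simplex_open : open (open_simplex p).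
Proof.
rewrite openE => x /open_simplexE hx.
have hk k : nbhs x [set y | 0 < bary k y].
  have cb : continuous (bary k) by apply: polyc_continuous; exact: bary_polyc.
  by apply: (cb x [set y | 0 < y]); apply: open_nbhs_nbhs; split; [exact: open_gt|exact: hx].
have nx := filter_forall (nbhs_filter x) hk.
apply: (@filterS _ (nbhs x) (nbhs_filter x) _ _ _ nx).
by move=> y; exact: (proj2 (open_simplexE y)).
Qed.

Lemma open_simplex_closed : open_simplex p `<=` closed_simplex p.
Proof. by move=> x [l [l0 l1 ->]]; exists l; split => // k; exact: ltW. Qed.

(** An open simplex is an intersection of half-spaces, so its indicator is the product of the
    indicators of [0 < bary k x]. *)
Lemma jmeas_open_simplex : jmeas (fun (_ : unit) x => \1_(open_simplex p) x : R).
Proof.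
have -> : (fun (_ : unit) x => \1_(open_simplex p) x : R) =
    (fun _ x => \prod_k (0 < bary k x)%R%:R).
  apply/funext => _; apply/funext => x; rewrite indicE.
  have [/[!inE] h|h] := boolP (x \in open_simplex p).
    by rewrite big1// => k _; rewrite (proj1 (open_simplexE x) h k).
  have : exists k, ~ (0 < bary k x).
    apply/existsNP => hk; move/negP: h; apply; rewrite inE.
    exact/open_simplexE.
  by move=> [k /negP/negbTE hk]; rewrite (bigD1 k)//= hk mul0r.
elim: (index_enum 'I_d.+1) => [|k r IH].
  by under eq_fun do under eq_fun do rewrite big_nil; apply: jmeas_cst; exact: measurable_cst.
under eq_fun do under eq_fun do rewrite big_cons.
apply: jmeasM => //; apply: jmeas_lt; first by apply: jmeas_cst; exact: measurable_cst.
by apply: polyc_jmeas; exact: bary_polyc.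
Qed.

End Simplex.

(** * Piecewise polynomials on a mesh *)

Section Domain.
Context {R : realType}.

Lemma polyhedral_bounded d (Om : set 'rV[R]_d) : polyhedral_domain Om ->
  exists L : R, 0 < L /\ forall x, Om x -> forall i, `|x ord0 i| <= L.
Proof.
move=> [_ _ _ [M [T [ndT ->]]]].
(* A bound for all vertex coordinates at once, hence for their convex combinations; the summand 1
   makes it positive. *)
pose L := 1 + \sum_m \sum_k \sum_i `|T m k ord0 i|.
have L0 : 0 < L.
  by rewrite ltr_pwDl// sumr_ge0// => m _; rewrite sumr_ge0// => k _; rewrite sumr_ge0.
exists L; split => // x /interior_subset [m _ [l [l0 l1 ->]]] i.
have TL k : `|T m k ord0 i| <= L.
  have le_sum (I : finType) (F : I -> R) j : (forall j, 0 <= F j) -> F j <= \sum_j F j.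
    by move=> F0; rewrite (bigD1 j)//= lerDl sumr_ge0.
  apply: le_trans (le_sum _ (fun i => `|T m k ord0 i|) i _) _ => //.
  apply: le_trans (le_sum _ (fun k => \sum_i `|T m k ord0 i|) k _) _.
    by move=> k'; exact: sumr_ge0.
  apply: le_trans (le_sum _ (fun m => \sum_k \sum_i `|T m k ord0 i|) m _) _.
    by move=> m'; apply: sumr_ge0 => k' _; exact: sumr_ge0.
  by rewrite lerDr.
rewrite summxE; apply: le_trans (ler_norm_sum _ _ _) _.
rewrite -[leRHS]mul1r -l1 mulr_suml; apply: ler_sum => k _.
by rewrite mxE normrM (ger0_norm (l0 k)) ler_wpM2l.
Qed.

(** The domain is the interior of a closed set [K], so its closure lies in [K] and the interior of
    that closure in the interior of [K]. Since a mesh only prescribes the closure of [Om], this is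
    what places its open simplices inside [Om]. *)
Lemma polyhedral_regular d (Om : set 'rV[R]_d) : polyhedral_domain Om ->
  interior (closure Om) `<=` Om.
Proof.
move=> [_ _ _ [M [T [ndT ->]]]].
set K := \bigcup_(m in _) _.
have cK : closed K.
  apply: closed_bigcup; first exact: finite_finset.
  by move=> m _; exact: closed_simplex_closed.
apply: interiorS; rewrite [X in _ `<=` X](proj1 (closure_id K) cK).
by apply: closureS; exact: interior_subset.
Qed.

End Domain.

Section Mesh.
Context {R : realType}.
Variables (d : nat) (Om : set 'rV[R]_d) (h : R) (M : nat).
Variable T : 'I_M -> 'I_d.+1 -> 'rV[R]_d.
Hypothesis Tmesh : mesh Om h T.
Hypothesis Om_regular : interior (closure Om) `<=` Om.
Variable L : R.
Hypothesis L0 : 0 <= L.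
Hypothesis OmL : forall x, Om x -> forall i, `|x ord0 i| <= L.

Let ndT m : Defs.nondegenerate (T m). Proof. by case: Tmesh. Qed.

Lemma simplex_sub_domain m : open_simplex (T m) `<=` Om.
Proof.
apply: subset_trans Om_regular.
rewrite -open_subsetE; last exact: open_simplex_open.
case: Tmesh => _ _ -> _ x hx; exists m => //.
exact: open_simplex_closed.
Qed.

(* Off these hyperplanes every point of [Om] is interior to a simplex of the mesh. *)
Definition generic (x : 'rV[R]_d) := forall m k, bary (T m) k x != 0.

Lemma aev_generic : aev generic.
Proof. by do 2!apply: aev_forall => ?; exact: aev_bary. Qed.

Lemma generic_cover x : generic x -> closure Om x ->
  exists m, open_simplex (T m) x.
Proof.
case: Tmesh => _ _ -> _ gx [m _ /(closed_simplexE (ndT m)) hx].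
exists m; apply/open_simplexE => // k.
by rewrite lt_def gx hx.
Qed.

Lemma simplex_disjoint m m' x :
  open_simplex (T m) x -> open_simplex (T m') x -> m = m'.
Proof.
move=> hx hx'; apply/eqP; apply: contraPT hx' => mm'.
have [_ /(_ _ _ mm') dis _ _] := Tmesh.
by move=> hx'; have : (open_simplex (T m) `&` open_simplex (T m')) x by []; rewrite dis.
Qed.

(** The representative that replaces an integrand: it vanishes on all faces, whatever the original
    values there. *)
Definition piecewise (P : 'I_M -> 'rV[R]_d -> R) (x : 'rV[R]_d) : R :=
  \sum_m \1_(open_simplex (T m)) x * P m x.

Lemma piecewise_in P m x : open_simplex (T m) x -> piecewise P x = P m x.
Proof.
move=> hx; rewrite /piecewise (bigD1 m)//= indicE mem_set// mul1r.
rewrite big1 ?addr0// => m' mm'; rewrite indicE memNset ?mul0r//.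
by move=> hx'; rewrite (simplex_disjoint hx hx') eqxx in mm'.
Qed.

Lemma piecewise_out P x : ~ Om x -> piecewise P x = 0.
Proof.
move=> nx; rewrite /piecewise big1// => m _.
by rewrite indicE memNset ?mul0r// => /simplex_sub_domain.
Qed.

Lemma good_piecewise P : (forall m, polyc (P m)) -> good L (piecewise P).
Proof.
move=> hP; split.
- rewrite /piecewise.
  elim: (index_enum 'I_M) => [|m r IH].
    by under eq_fun do under eq_fun do rewrite big_nil; apply: jmeas_cst; exact: measurable_cst.
  under eq_fun do under eq_fun do rewrite big_cons.
  apply: jmeasD => //; apply: jmeasM; first exact: jmeas_open_simplex.
  exact: polyc_jmeas.
- have /choice[K hK] : forall m, exists K : R, 0 <= K /\
      forall x : 'rV[R]_d, (forall i, `|x ord0 i| <= L) -> `|P m x| <= K.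
    by move=> m; exact: polyc_bounded.
  exists (\sum_m K m) => x.
  have [Ox|nOx] := pselect (Om x); last first.
    by rewrite piecewise_out// normr0 sumr_ge0// => m _; case: (hK m).
  apply: le_trans (ler_norm_sum _ _ _) _; apply: ler_sum => m _.
  have [Km0 Km] := hK m; rewrite indicE; case: (x \in _).
    by rewrite mul1r; apply: Km; exact: OmL.
  by rewrite mul0r normr0.
- move=> x; have [Ox _|nOx] := pselect (Om x); first exact: OmL.
  by rewrite piecewise_out// eqxx.
Qed.

(** Values on the faces and outside the mesh are left free, so that classical partial derivatives of
    piecewise polynomials belong to the class. *)
Definition ppoly (g : 'rV[R]_d -> R) :=
  forall m, exists2 p, polyc p & forall x, open_simplex (T m) x -> g x = p x.

Lemma ppoly_polyc p : polyc p -> ppoly p.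
Proof. by move=> pp m; exists p. Qed.

Lemma ppolyD f g : ppoly f -> ppoly g -> ppoly (fun x => f x + g x).
Proof.
move=> hf hg m; have [p pp hp] := hf m; have [q pq hq] := hg m.
exists (fun x => p x + q x); first exact: polyc_add.
by move=> x hx; rewrite hp// hq.
Qed.

Lemma ppolyM f g : ppoly f -> ppoly g -> ppoly (fun x => f x * g x).
Proof.
move=> hf hg m; have [p pp hp] := hf m; have [q pq hq] := hg m.
exists (fun x => p x * q x); first exact: polyc_mul.
by move=> x hx; rewrite hp// hq.
Qed.

Lemma ppoly_cst c : ppoly (fun _ => c).
Proof. by apply: ppoly_polyc; exact: polyc_cst. Qed.

Lemma ppoly_sum (I : Type) (r : seq I) (g : I -> 'rV[R]_d -> R) :
  (forall i, ppoly (g i)) -> ppoly (fun x => \sum_(i <- r) g i x).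
Proof.
move=> hg; elim: r => [|i r IH].
  by under eq_fun do rewrite big_nil; exact: ppoly_cst.
by under eq_fun do rewrite big_cons; exact: ppolyD.
Qed.

Lemma ppoly_is_derive g m x v : ppoly g -> open_simplex (T m) x ->
  is_derive x v g ('D_v g x).
Proof.
move=> /(_ m)[p hp gp] hx.
have [q hq dq] := polyc_derive v hp.
have : is_derive x v g (q x).
  apply: near_eq_is_derive (dq x).
  have : nbhs x (open_simplex (T m)).
    by apply: open_nbhs_nbhs; split => //; exact: open_simplex_open.
  by apply: (@filterS _ (nbhs x) (nbhs_filter x)) => y /gp ->.
by move=> hd; rewrite derive_val.
Qed.

Lemma ppoly_derive g v : ppoly g -> ppoly ('D_v g).
Proof.
move=> hg m; have [p hp gp] := hg m.
have [q hq dq] := polyc_derive v hp; exists q => // x hx.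
suff : is_derive x v g (q x) by move=> hd; rewrite derive_val.
apply: near_eq_is_derive (dq x).
have : nbhs x (open_simplex (T m)).
  by apply: open_nbhs_nbhs; split => //; exact: open_simplex_open.
by apply: (@filterS _ (nbhs x) (nbhs_filter x)) => y /gp ->.
Qed.

(** A generic point of [Om] lies in exactly one open simplex, so the integrand with its cut-off
    agrees there with a representative in the class [good]; [iint_aev] then identifies the
    integrals. *)
Lemma ppoly_good g : ppoly g -> exists P : 'I_M -> 'rV[R]_d -> R,
  [/\ forall m, polyc (P m),
      forall m x, open_simplex (T m) x -> g x = P m x,
      good L (piecewise P)
    & intOm Om g = iint (piecewise P)].
Proof.
move=> hg.
have /choice[P hP] : forall m, exists p, polyc p /\
    forall x, open_simplex (T m) x -> g x = p x.
  by move=> m; have [p ? ?] := hg m; exists p.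
have gP : good L (piecewise P) by apply: good_piecewise => m; case: (hP m).
exists P; split => //; [by move=> m; case: (hP m)|by move=> m; case: (hP m)|].
apply: (iint_aev L0 gP); apply: aev_imp aev_generic => x gx.
have [Ox|nOx] := pselect (Om x); last first.
  by rewrite piecewise_out// indicE memNset// mul0r.
have [m hx] := generic_cover gx (subset_closure Ox).
by rewrite (piecewise_in _ hx) indicE mem_set// mul1r; case: (hP m) => _ ->.
Qed.

Lemma intOm_eq f g : ppoly g ->
  (forall m x, open_simplex (T m) x -> f x = g x) -> intOm Om f = intOm Om g.
Proof.
move=> hg fg; have [P [hP gP goodP ->]] := ppoly_good hg.
apply: (iint_aev L0 goodP); apply: aev_imp aev_generic => x gx.
have [Ox|nOx] := pselect (Om x); last first.
  by rewrite piecewise_out// indicE memNset// mul0r.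
have [m hx] := generic_cover gx (subset_closure Ox).
by rewrite (piecewise_in _ hx) indicE mem_set// mul1r (fg m)// (gP m).
Qed.

Lemma intOm_lin a f g : ppoly f -> ppoly g ->
  intOm Om (fun x => a * f x + g x) = a * intOm Om f + intOm Om g.
Proof.
move=> hf hg; have [P [hP fP goodP ->]] := ppoly_good hf.
have [Q [hQ gQ goodQ ->]] := ppoly_good hg.
rewrite -(iint_lin a L0 goodP goodQ).
have e : (fun y => a * piecewise P y + piecewise Q y) =
    piecewise (fun m x => a * P m x + Q m x).
  apply/funext => x; rewrite /piecewise mulr_sumr -big_split/=.
  by apply: eq_bigr => m _; rewrite mulrDr mulrCA.
rewrite e; apply: (iint_aev L0).
  apply: good_piecewise => m; apply: polyc_add => //.
  by apply: polyc_mul => //; exact: polyc_cst.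
apply: aev_imp aev_generic => x gx.
have [Ox|nOx] := pselect (Om x); last first.
  by rewrite piecewise_out// indicE memNset// mul0r.
have [m hx] := generic_cover gx (subset_closure Ox).
by rewrite (piecewise_in _ hx) indicE mem_set// mul1r (fP m)// (gQ m).
Qed.

Lemma intOm_ge0 f : (forall x, Om x -> 0 <= f x) -> 0 <= intOm Om f.
Proof.
move=> f0; apply: iint_ge0 => x; rewrite indicE.
case: (asboolP (Om x)) => [Ox|nOx]; first by rewrite mem_set// mul1r f0.
by rewrite memNset// mul0r.
Qed.

Lemma intOm_sum (I : Type) (r : seq I) (a : I -> R) (g : I -> 'rV[R]_d -> R) :
  (forall i, ppoly (g i)) ->
  intOm Om (fun x => \sum_(i <- r) a i * g i x) = \sum_(i <- r) a i * intOm Om (g i).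
Proof.
move=> hg; elim: r => [|i r IH].
  rewrite big_nil /intOm; under eq_fun do rewrite big_nil mulr0.
  exact: iint0.
rewrite big_cons -IH -intOm_lin//; last first.
  by apply: ppoly_sum => j; apply: ppolyM => //; exact: ppoly_cst.
by congr intOm; apply/funext => x; rewrite big_cons.
Qed.

Lemma ppoly_L2 f : ppoly f ->
  (iintE (fun x => ((\1_Om x : R) * f x)%:E) < +oo)%E.
Proof.
move=> hf; have [P [hP fP goodP _]] := ppoly_good hf.
rewrite (iintE_aev (g := piecewise P) L0 goodP) ?ltry//.
apply: aev_imp aev_generic => x gx; congr _%:E.
have [Ox|nOx] := pselect (Om x); last first.
  by rewrite piecewise_out// indicE memNset// mul0r.
have [m hx] := generic_cover gx (subset_closure Ox).
by rewrite (piecewise_in _ hx) indicE mem_set// mul1r (fP m).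
Qed.

End Mesh.

(** * The divergence theorem for piecewise polynomials *)

Section DivergenceTheorem.
Context {R : realType}.
Local Notation mu := (@lebesgue_measure R).

(** Induction on the exceptional points: with none left the mean value theorem applies, and a point
    inside the interval splits it in two. *)
Lemma cst_off_finite (G : R -> R) (S : seq R) (a b : R) : a <= b ->
  {within `[a, b], continuous G} ->
  (forall x, x \in `]a, b[ -> x \notin S -> is_derive x 1 G 0) -> G a = G b.
Proof.
elim: S a b => [|s S IH] a b ab cG dG.
  have [x y|c _ /eqP] := @MVT_segment _ G (fun=> 0) a b ab _ cG; first exact: dG.
  by rewrite mul0r subr_eq0 eq_sym => /eqP.
have [sab|sab] := boolP (s \in `]a, b[); last first.
  apply: (IH a b ab cG) => x xab xS; apply: (dG x xab).
  by rewrite inE negb_or xS andbT; apply: contraNneq sab => <-.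
have /andP[as_ sb] : a < s < b by move: sab; rewrite in_itv.
have c1 : {within `[a, s], continuous G}.
  apply: continuous_subspaceW cG => x /=; rewrite !in_itv/= => /andP[-> xs] /=.
  exact: le_trans xs (ltW sb).
have c2 : {within `[s, b], continuous G}.
  apply: continuous_subspaceW cG => x /=; rewrite !in_itv/= => /andP[sx ->].
  by rewrite andbT (le_trans (ltW as_)).
have d1 x : x \in `]a, s[ -> x \notin S -> is_derive x 1 G 0.
  rewrite in_itv/= => /andP[ax xs] xS; apply: (dG x).
    by rewrite in_itv/= ax (lt_trans xs).
  by rewrite inE negb_or xS andbT lt_eqF.
have d2 x : x \in `]s, b[ -> x \notin S -> is_derive x 1 G 0.
  rewrite in_itv/= => /andP[sx xb] xS; apply: (dG x).
    by rewrite in_itv/= xb andbT (lt_trans as_).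
  by rewrite inE negb_or xS andbT gt_eqF.
exact: etrans (IH a s (ltW as_) c1 d1) (IH s b (ltW sb) c2 d2).
Qed.

(* [w] minus the primitive of [q] is continuous with zero derivative off [S], hence constant. *)
Lemma integral_derivative0 (w q : R -> R) (S : seq R) (B L : R) :
  0 <= B -> 0 <= L -> continuous w -> measurable_fun setT q ->
  (forall x, `|q x| <= B) ->
  (forall x, q x != 0 -> `|x| <= L) -> (forall x, w x != 0 -> `|x| <= L) ->
  (forall x, x \notin S -> is_derive x 1 w (q x) /\ {for x, continuous q}) ->
  Rintegral mu setT q = 0.
Proof.
move=> B0 L0 cw mq qB qL wL dwq.
have iq := box_integrable mq B0 qB qL.
(* The endpoints lie strictly outside the supports, so [w] vanishes at both and the integral over
   the interval is the full one. *)
pose a := - L - 1; pose b := L + 1.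
have ab : a < b by rewrite /a /b; lra.
have iab u : mu.-integrable `[a, u] (EFin \o q).
  by apply: integrableS iq => //; exact: measurable_itv.
pose F x := Rintegral mu `[a, x]%classic q.
have -> : Rintegral mu setT q = F b.
  rewrite /F [RHS]Rintegral_mkcond; congr (Rintegral _ _); apply/funext => x.
  rewrite patchE; case: ifPn => // /negP xab; apply/eqP.
  apply: contraPT xab => /qL xL; apply; rewrite inE /= in_itv /=.
  by move: xL; rewrite ler_norml /a /b => /andP[? ?]; apply/andP; split; lra.
have cF : {within `[a, b], continuous F}.
  exact: (parameterized_integral_continuous (ltW ab) (iab b)).
have w0 x : L < `|x| -> w x = 0.
  by move=> Lx; apply/eqP; apply: contraTT Lx => /wL; rewrite leNgt.
have : w a - F a = w b - F b.
  apply: (@cst_off_finite (fun x => w x - F x) S a b (ltW ab)).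
    by move=> x; apply: continuousB; [exact: continuous_subspaceT|exact: cF].
  move=> x; rewrite in_itv/= => /andP[ax xb] /dwq[dw cq].
  have [dF FE] := @continuous_FTC1_closed R q a x b xb (iab b) ax cq.
  have dF' : is_derive x 1 F (q x).
    by split; [exact: dF|rewrite -derive1E; exact: FE].
  by have := is_deriveB dw dF'; rewrite subrr.
rewrite /F set_itv1 Rintegral_set1 subr0 !w0; last 2 first.
- by rewrite ger0_norm /b; lra.
- by rewrite ler0_norm /a; lra.
by move=> /eqP; rewrite sub0r eq_sym oppr_eq0 => /eqP.
Qed.

(** A directional derivative only sees difference quotients along a line, and [g] carries the line
    through [a] to the line through [g a]. It transfers derivatives to slices. *)
Lemma is_derive_comp_shift (V V' W : normedModType R) (g : V -> V') (a v : V)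
    (v' : V') (f : V' -> W) df :
  (forall t : R, g (t *: v + a) = t *: v' + g a) ->
  is_derive (g a) v' f df -> is_derive a v (f \o g) df.
Proof.
move=> hg [dfa <-].
have e : (fun t : R => t^-1 *: ((f \o g) (t *: v + a) - (f \o g) a)) =
    (fun t => t^-1 *: (f (t *: v' + g a) - f (g a))).
  by apply/funext => t /=; rewrite hg.
apply: DeriveDef.
  move: dfa; rewrite /derivable.
  by rewrite (_ : (fun h : R => _) = (fun t => t^-1 *: (f (t *: v' + g a) - f (g a)))) // -e.
rewrite /derive.
by rewrite (_ : (fun h : R => _) = (fun t => t^-1 *: ((f \o g) (t *: v + a) - (f \o g) a))) // e.
Qed.

Lemma vcons_continuous n (x : R) : continuous (@vcons R n x).
Proof.
move=> y A [P hP PA].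
exists (fun i j => P i (lift ord0 j)) => [i j|N hN].
  by have := hP i (lift ord0 j); rewrite [i]ord1 vconsS.
apply: PA => i j; rewrite [i]ord1; case: (unliftP ord0 j) => [k ->|->].
  by rewrite vconsS -(ord1 ord0); exact: hN.
rewrite vcons0; have := hP ord0 ord0; rewrite vcons0; exact: nbhs_singleton.
Qed.

Lemma vconsl_continuous n (y : 'rV[R]_n) : continuous (fun x => vcons x y).
Proof.
move=> x A [P hP PA].
have h0 : nbhs x (P ord0 ord0) by have := hP ord0 ord0; rewrite vcons0.
apply: filterS h0 => t ht; apply: PA => i j; rewrite [i]ord1.
case: (unliftP ord0 j) => [k ->|->]; last by rewrite vcons0.
by rewrite vconsS; have := hP ord0 (lift ord0 k); rewrite vconsS; exact: nbhs_singleton.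
Qed.

Lemma vcons_shift n (t x : R) (v y : 'rV[R]_n) :
  vcons x (t *: v + y) = t *: vcons 0 v + vcons x y.
Proof.
apply/rowP => j.
have -> : (t *: vcons 0 v + vcons x y) ord0 j = t * vcons 0 v ord0 j + vcons x y ord0 j.
  by rewrite !mxE.
case: (unliftP ord0 j) => [k ->|->]; first by rewrite !vconsS !mxE.
by rewrite !vcons0 mulr0 add0r.
Qed.

Lemma vcons_delta_max n :
  vcons 0 (delta_mx ord0 ord_max : 'rV[R]_n.+1) = delta_mx ord0 ord_max.
Proof.
apply/rowP => j; rewrite [RHS]mxE.
case: (unliftP ord0 j) => [k ->|->]; last by rewrite vcons0.
by rewrite vconsS mxE.
Qed.

(** The last variable is the innermost one, so the inner integral already vanishes and the order of
    integration is never changed. Outer slices contained in one of the exceptional hyperplanes are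
    countably many; on the others the hypotheses are inherited. *)
Lemma iint_derive_last n (W Q : 'rV[R]_n.+1 -> R) (I : finType) (a : I -> R)
    (b : I -> 'I_n.+1 -> R) (L : R) :
  0 <= L -> continuous W -> (forall x : 'rV[R]_n.+1, W x != 0 -> forall i, `|x ord0 i| <= L) ->
  good L Q ->
  (forall i, exists x : 'rV[R]_n.+1, a i + \sum_j x ord0 j * b i j != 0) ->
  (forall x : 'rV[R]_n.+1, (forall i, a i + \sum_j x ord0 j * b i j != 0) ->
    is_derive x (delta_mx ord0 ord_max) W (Q x) /\ {for x, continuous Q}) ->
  iint Q = 0.
Proof.
move=> L0; elim: n W Q a b => [|n IH] W Q a b cW WL gQ hab dWQ.
  have [mQ [K QK] QL] := gQ.
  (* The zeros of the affine functions of one variable. If [b i ord0] is 0, the function is a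
     nonzero constant and the quotient merely adds the point 0. *)
  pose S := [seq - a i / b i ord0 | i <- enum I].
  have K0 : 0 <= K := le_trans (normr_ge0 _) (QK 0).
  pose w t := W (vcons t 0); pose q t := Q (vcons t 0).
  apply: (@integral_derivative0 w q S K L K0 L0).
  - move=> t; apply: (@continuous_comp _ _ _ (fun t => vcons t 0) W).
      exact: vconsl_continuous.
    exact: cW.
  - exact: (measurable_iint_vcons mQ).
  - by move=> x; exact: QK.
  - by move=> x /QL /(_ ord0); rewrite vcons0.
  - by move=> x /WL /(_ ord0); rewrite vcons0.
  move=> t tS.
  have gt i : a i + \sum_j (vcons t (0 : 'rV[R]_0)) ord0 j * b i j != 0.
    rewrite big_ord1 vcons0; have [z] := hab i; rewrite big_ord1.
    have [->|bi0 _] := eqVneq (b i ord0) 0; first by rewrite !mulr0.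
    apply: contraNneq tS => e; apply/mapP; exists i; first by rewrite mem_enum.
    by rewrite -[t](mulfK bi0); congr (_ / _); apply/eqP; rewrite -addr_eq0 addrC e.
  have [dW cQ] := dWQ _ gt.
  split; last first.
    apply: (@continuous_comp _ _ _ (fun t => vcons t 0) Q); last exact: cQ.
    exact: vconsl_continuous.
  have hs (s : R) : vcons (s *: 1 + t) (0 : 'rV[R]_0) =
      s *: delta_mx ord0 ord_max + vcons t 0.
    apply/rowP => j; rewrite [j]ord1 vcons0.
    have -> : (s *: delta_mx ord0 ord_max + vcons t (0 : 'rV[R]_0)) ord0 ord0 =
        s * delta_mx ord0 (ord_max : 'I_1) (ord0 : 'I_1) ord0 + vcons t (0 : 'rV[R]_0) ord0 ord0.
      by rewrite !mxE.
    by rewrite vcons0 mxE.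
  exact: (is_derive_comp_shift hs dW).
have cS i := countable_affine_slice (hab i).
pose S := \bigcup_(i in [set: I]) [set x | forall y : 'rV[R]_n.+1,
    a i + x * b i ord0 + \sum_j y ord0 j * b i (lift ord0 j) = 0].
have cS' : countable S.
  by apply: bigcup_countable => [|i _]; [exact: countableP|exact: cS].
rewrite /= /Rintegral (@integral_countable_modif R _ (cst 0%E) S) ?integral0//.
move=> x nS; congr _%:E.
apply: (IH (fun y => W (vcons x y)) (fun y => Q (vcons x y))
   (fun i => a i + x * b i ord0) (fun i j => b i (lift ord0 j))).
- move=> y; apply: (@continuous_comp _ _ _ (vcons x) W); last exact: cW.
  exact: vcons_continuous.
- by move=> y /WL h i; have := h (lift ord0 i); rewrite vconsS.
- exact: good_vcons.
- move=> i; apply: contrapT => h; apply: nS; exists i => // y.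
  by apply/eqP; apply: contrapT => /negP hy; apply: h; exists y.
- move=> y hy.
  have gy i : a i + \sum_j vcons x y ord0 j * b i j != 0.
    rewrite big_ord_recl vcons0 addrA.
    by under eq_bigr do rewrite vconsS.
  have [dW cQ] := dWQ _ gy; split; last first.
    apply: (@continuous_comp _ _ _ (vcons x) Q); last exact: cQ.
    exact: vcons_continuous.
  apply: (is_derive_comp_shift _ dW) => s.
  by rewrite vcons_shift vcons_delta_max.
Qed.

End DivergenceTheorem.

(** * Derivatives of piecewise polynomials vanishing off the domain *)

Section MeshDivergence.
Context {R : realType}.
Variables (n : nat) (Om : set 'rV[R]_n.+1) (h : R) (M : nat).
Variable T : 'I_M -> 'I_n.+2 -> 'rV[R]_n.+1.
Hypothesis Tmesh : mesh Om h T.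
Hypothesis Om_regular : interior (closure Om) `<=` Om.
Variable L : R.
Hypothesis L0 : 0 <= L.
Hypothesis OmL : forall x, Om x -> forall i, `|x ord0 i| <= L.

Let ndT m : Defs.nondegenerate (T m). Proof. by case: Tmesh. Qed.

(** A generic point is either interior to a simplex, where [W] is a polynomial, or in the open
    complement of [closure Om], where [W] and the representative of its derivative vanish. Either
    way [iint_derive_last] applies. *)
Lemma intOm_derive_last (W : 'rV[R]_n.+1 -> R) :
  continuous W -> (forall x, ~ Om x -> W x = 0) -> ppoly T W ->
  intOm Om ('D_(delta_mx ord0 ord_max) W) = 0.
Proof.
move=> cW W0 ppW.
have [P [hP DP goodP ->]] :=
  ppoly_good Tmesh Om_regular L0 OmL (ppoly_derive Tmesh (delta_mx ord0 ord_max) ppW).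
have /choice[a /choice[b hab]] : forall mk : 'I_M * 'I_n.+2, exists (a : R)
    (b : 'I_n.+1 -> R), forall x, bary (T mk.1) mk.2 x = a + \sum_i x ord0 i * b i.
  by move=> mk; exact: bary_affine.
apply: (iint_derive_last (a := a) (b := b) L0 cW _ goodP).
- move=> x Wx0; apply: OmL; apply: contrapT => nOx.
  by rewrite W0// eqxx in Wx0.
- by move=> mk; exists (T mk.1 mk.2); rewrite -hab bary_vertex ?oner_neq0.
move=> x hx.
have gx : generic T x by move=> m k; have := hx (m, k); rewrite -hab.
have [clx|nclx] := pselect (closure Om x).
  have [m xm] := generic_cover Tmesh gx clx.
  have nm : nbhs x (open_simplex (T m)).
    by apply: open_nbhs_nbhs; split => //; exact: open_simplex_open.
  split.
    rewrite (piecewise_in Tmesh P xm) -(DP m)//.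
    exact: (ppoly_is_derive Tmesh _ ppW xm).
  have cP : {for x, continuous (P m)}.
    by apply: polyc_continuous; exact: hP.
  have ne : nbhs x [set y | P m y = piecewise T P y].
    apply: (@filterS _ (nbhs x) (nbhs_filter x) _ _ _ nm) => y ym /=.
    by rewrite (piecewise_in Tmesh P ym).
  rewrite /prop_for /continuous_at (piecewise_in Tmesh P xm).
  exact: cvg_trans (@near_eq_cvg _ _ (nbhs x) (nbhs_filter x) _ _ ne) cP.
have nO : nbhs x (~` closure Om).
  apply: open_nbhs_nbhs; split => //; apply: closed_openC; exact: closed_closure.
have nOm y : (~` closure Om) y -> ~ Om y by move=> hy Oy; apply: hy; exact: subset_closure.
have Q0 y : (~` closure Om) y -> piecewise T P y = 0.
  by move=> /nOm; exact: (piecewise_out Tmesh Om_regular).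
split.
  rewrite Q0//; apply: near_eq_is_derive (is_derive_cst 0 x _).
  by apply: (@filterS _ (nbhs x) (nbhs_filter x) _ _ _ nO) => y /nOm /W0 ->.
rewrite /prop_for /continuous_at Q0//.
have ne : nbhs x [set y | (fun=> 0) y = piecewise T P y].
  by apply: (@filterS _ (nbhs x) (nbhs_filter x) _ _ _ nO) => y /Q0 /= ->.
have c0 : {for x, continuous (fun _ : 'rV[R]_n.+1 => 0 : R)} by exact: cst_continuous.
exact: cvg_trans (@near_eq_cvg _ _ (nbhs x) (nbhs_filter x) _ _ ne) c0.
Qed.

End MeshDivergence.

(** * Gram matrices of a finite element basis *)

Definition dot {R : realType} {N} (a b : 'cV[R]_N) : R :=
  \sum_i a i ord0 * b i ord0.

Section FiniteElementForms.
Context {R : realType}.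
Variables (n : nat) (Om : set 'rV[R]_n.+1) (h : R) (M : nat).
Variable T : 'I_M -> 'I_n.+2 -> 'rV[R]_n.+1.
Hypothesis Tmesh : mesh Om h T.
Hypothesis Om_regular : interior (closure Om) `<=` Om.
Variable L : R.
Hypothesis L0 : 0 <= L.
Hypothesis OmL : forall x, Om x -> forall i, `|x ord0 i| <= L.
Variables (N : nat) (phi : 'I_N -> 'rV[R]_n.+1 -> 'rV[R]_n.+1).
Hypothesis cphi : forall i, continuous (phi i).
Hypothesis phi0 : forall i x, ~ Om x -> phi i x = 0.
Hypothesis ppphi : forall i j, ppoly T (fun x => phi i x ord0 j).

Let ndT m : Defs.nondegenerate (T m). Proof. by case: Tmesh. Qed.

Lemma combo_coord (a : 'cV[R]_N) x j :
  combo phi a x ord0 j = \sum_l a l ord0 * phi l x ord0 j.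
Proof. by rewrite /combo summxE; apply: eq_bigr => l _; rewrite mxE. Qed.

Lemma ppoly_combo a j : ppoly T (fun x => combo phi a x ord0 j).
Proof.
rewrite (funext (fun x => combo_coord a x j)).
by apply: ppoly_sum => l; apply: ppolyM; [exact: ppoly_cst|exact: ppphi].
Qed.

Lemma combo_out a x : ~ Om x -> combo phi a x = 0.
Proof. by move=> nOx; rewrite /combo big1// => l _; rewrite phi0// scaler0. Qed.

Lemma combo_continuous a j : continuous (fun x => combo phi a x ord0 j).
Proof.
rewrite (funext (fun x => combo_coord a x j)) => x.
elim: (index_enum _) => [|l r IH].
  by under eq_fun do rewrite big_nil; exact: cst_continuous.
under eq_fun do rewrite big_cons.
have c1 : {for x, continuous (fun y => phi l y ord0 j)}.
  apply: (@continuous_comp _ _ _ (phi l) (fun y => y ord0 j)); first exact: cphi.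
  exact: coord_continuous.
have c0 : {for x, continuous (fun _ : 'rV[R]_n.+1 => a l ord0)} by exact: cst_continuous.
exact: continuousD (continuousM c0 c1) IH.
Qed.

Lemma ppoly_pd (v : 'rV[R]_n.+1 -> 'rV[R]_n.+1) i k :
  ppoly T (fun x => v x ord0 i) -> ppoly T (pd v i k).
Proof. by move=> pv; apply: (ppoly_derive Tmesh). Qed.

(** Restricted to open simplices, since on faces the basis functions may fail to be differentiable
    and [derive] need not be additive. *)
Lemma pd_combo a i k m x : open_simplex (T m) x ->
  pd (combo phi a) i k x = \sum_l a l ord0 * pd (phi l) i k x.
Proof.
move=> xm; rewrite /pd (funext (fun x => combo_coord a x i)).
set e := delta_mx _ _.
have hd l := ppoly_is_derive Tmesh e (ppphi l i) xm.
suff : is_derive x e (fun y => \sum_l a l ord0 * phi l y ord0 i)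
    (\sum_l a l ord0 * 'D_e (fun y => phi l y ord0 i) x).
  by move=> H; rewrite derive_val.
elim: (index_enum _) => [|l r IH].
  rewrite big_nil; under eq_fun do rewrite big_nil.
  exact: is_derive_cst.
rewrite big_cons; under eq_fun do rewrite big_cons.
exact: (is_deriveD (is_deriveZ (a l ord0) (hd l)) IH).
Qed.

Lemma divg_combo a m x : open_simplex (T m) x ->
  divg (combo phi a) x = \sum_l a l ord0 * divg (phi l) x.
Proof.
move=> xm; rewrite /divg.
under eq_bigr do rewrite (pd_combo a _ _ xm).
by rewrite exchange_big; apply: eq_bigr => l _; rewrite mulr_sumr.
Qed.

(** One reduction to a Gram matrix for all three forms; the expansion of [F] is asked only inside
    the simplices, where derivatives of combinations expand. *)
Lemma intOm_bilinear (F : 'rV[R]_n.+1 -> R) (f : 'I_N -> 'I_N -> 'rV[R]_n.+1 -> R)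
    (a b : 'cV[R]_N) :
  (forall i j, ppoly T (f i j)) ->
  (forall m x, open_simplex (T m) x ->
     F x = \sum_i a i ord0 * \sum_j b j ord0 * f i j x) ->
  intOm Om F = dot a ((\matrix_(i, j) intOm Om (f i j)) *m b).
Proof.
move=> ppf hF.
have pps i : ppoly T (fun x => \sum_j b j ord0 * f i j x).
  by apply: ppoly_sum => j; apply: ppolyM => //; exact: ppoly_cst.
rewrite (intOm_eq Tmesh Om_regular L0 OmL (g := fun x =>
  \sum_i a i ord0 * \sum_j b j ord0 * f i j x))//; last first.
  by apply: ppoly_sum => i; apply: ppolyM => //; exact: ppoly_cst.
rewrite (intOm_sum Tmesh Om_regular L0 OmL)//; apply: eq_bigr => i _; congr (_ * _).
rewrite (intOm_sum Tmesh Om_regular L0 OmL)// mxE; apply: eq_bigr => j _.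
by rewrite mxE mulrC.
Qed.

Definition mass_mx : 'M[R]_N := \matrix_(i, j) ip Om (phi i) (phi j).
Definition grad_mx : 'M[R]_N := \matrix_(i, j) ipgrad Om (phi i) (phi j).
Definition div_mx : 'M[R]_N := \matrix_(i, j) ipdiv Om (phi i) (phi j).

Lemma ip_combo a b : ip Om (combo phi a) (combo phi b) = dot a (mass_mx *m b).
Proof.
apply: intOm_bilinear => [i j|m x xm].
  by apply: ppoly_sum => k; exact: ppolyM.
under eq_bigr do rewrite !combo_coord mulr_suml.
rewrite exchange_big; apply: eq_bigr => i _ /=.
under eq_bigr do rewrite -mulrA mulr_sumr.
rewrite -mulr_sumr exchange_big; congr (_ * _); apply: eq_bigr => j _ /=.
by rewrite mulr_sumr; apply: eq_bigr => k _; rewrite mulrCA.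
Qed.

Lemma ipgrad_combo a b :
  ipgrad Om (combo phi a) (combo phi b) = dot a (grad_mx *m b).
Proof.
apply: intOm_bilinear => [i j|m x xm].
  by do 2![apply: ppoly_sum => ?]; apply: ppolyM; exact: ppoly_pd.
rewrite pair_bigA /=.
under eq_bigr do rewrite !(pd_combo _ _ _ xm) mulr_suml.
rewrite exchange_big; apply: eq_bigr => i _ /=.
under eq_bigr do rewrite -mulrA mulr_sumr.
rewrite -mulr_sumr exchange_big; congr (_ * _); apply: eq_bigr => j _ /=.
rewrite pair_bigA /= mulr_sumr; apply: eq_bigr => k _; by rewrite mulrCA.
Qed.

Lemma ipdiv_combo a b :
  ipdiv Om (combo phi a) (combo phi b) = dot a (div_mx *m b).
Proof.
have ppd l : ppoly T (divg (phi l)) by apply: ppoly_sum => k; exact: ppoly_pd.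
apply: intOm_bilinear => [i j|m x xm]; first exact: ppolyM.
rewrite !(divg_combo _ xm) mulr_suml; apply: eq_bigr => i _.
rewrite -mulrA; congr (_ * _); rewrite mulr_sumr; apply: eq_bigr => j _.
by rewrite mulrCA.
Qed.

Lemma penalty_matrixE eps : penalty_matrix Om phi eps = grad_mx + eps^-1 *: div_mx.
Proof. by apply/matrixP => i j; rewrite !mxE. Qed.

Lemma mass_mx_sym : mass_mx^T = mass_mx.
Proof.
apply/matrixP => i j; rewrite !mxE; congr intOm; apply/funext => x.
by apply: eq_bigr => k _; rewrite mulrC.
Qed.

Lemma grad_mx_sym : grad_mx^T = grad_mx.
Proof.
apply/matrixP => i j; rewrite !mxE; congr intOm; apply/funext => x.
by do 2![apply: eq_bigr => ? _]; rewrite mulrC.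
Qed.

Lemma div_mx_sym : div_mx^T = div_mx.
Proof.
by apply/matrixP => i j; rewrite !mxE; congr intOm; apply/funext => x; rewrite mulrC.
Qed.

Lemma mass_mx_ge0 a : 0 <= dot a (mass_mx *m a).
Proof.
rewrite -ip_combo; apply: intOm_ge0 => x _.
by apply: sumr_ge0 => i _; rewrite -expr2 sqr_ge0.
Qed.

Lemma grad_mx_ge0 a : 0 <= dot a (grad_mx *m a).
Proof.
rewrite -ipgrad_combo; apply: intOm_ge0 => x _.
by do 2![apply: sumr_ge0 => ? _]; rewrite -expr2 sqr_ge0.
Qed.

Lemma div_mx_ge0 a : 0 <= dot a (div_mx *m a).
Proof. by rewrite -ipdiv_combo; apply: intOm_ge0 => x _; rewrite -expr2 sqr_ge0. Qed.

(** Cauchy-Schwarz against the constant 1, obtained by expanding the nonnegative double sum of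
    [(f i - f j) ^+ 2]. *)
Lemma sqr_sum_le (I : finType) (f : I -> R) :
  (\sum_i f i) ^+ 2 <= #|I|%:R * \sum_i f i ^+ 2.
Proof.
have : 0 <= \sum_i \sum_j (f i - f j) ^+ 2.
  by do 2![apply: sumr_ge0 => ? _]; exact: sqr_ge0.
have -> : \sum_i \sum_j (f i - f j) ^+ 2 =
    2 * (#|I|%:R * \sum_i f i ^+ 2) - 2 * (\sum_i f i) ^+ 2.
  rewrite -!mulrBr.
  have e i : \sum_j (f i - f j) ^+ 2 =
      #|I|%:R * f i ^+ 2 + \sum_j f j ^+ 2 - 2 * (f i * \sum_j f j).
    rewrite mulr_natl -[f i ^+ 2 *+ _]sumr_const -big_split /= !mulr_sumr -sumrB.
    by apply: eq_bigr => j _; ring.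
  under eq_bigr do rewrite e.
  rewrite sumrB big_split /= sumr_const -mulr_sumr -[_ *+ #|I|]mulr_natl.
  rewrite -mulr_sumr -mulr_suml -expr2.
  by ring.
by rewrite subr_ge0 ler_pM2l.
Qed.

Lemma ppoly_gradsq a :
  ppoly T (fun x => \sum_i \sum_k pd (combo phi a) i k x * pd (combo phi a) i k x).
Proof.
by do 2![apply: ppoly_sum => ?]; apply: ppolyM; apply: ppoly_pd; exact: ppoly_combo.
Qed.

Lemma intOm_le f g : ppoly T f -> ppoly T g ->
  (forall x, Om x -> f x <= g x) -> intOm Om f <= intOm Om g.
Proof.
move=> ppf ppg fg; rewrite -subr_ge0.
have -> : intOm Om g - intOm Om f = intOm Om (fun x => -1 * f x + g x).
  by rewrite (intOm_lin Tmesh Om_regular L0 OmL)//; ring.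
by apply: intOm_ge0 => x /fg; lra.
Qed.

(** Pointwise, the squared trace of the Jacobian is at most the dimension times the sum of the
    squared diagonal entries, hence of all squared entries. *)
Lemma div_le_grad a :
  dot a (div_mx *m a) <= n.+1%:R * dot a (grad_mx *m a).
Proof.
rewrite -ipdiv_combo -ipgrad_combo.
have ppg := ppoly_gradsq a.
have -> : n.+1%:R * ipgrad Om (combo phi a) (combo phi a) = intOm Om (fun x =>
    n.+1%:R * (\sum_i \sum_k pd (combo phi a) i k x * pd (combo phi a) i k x) + 0).
  rewrite (intOm_lin Tmesh Om_regular L0 OmL)//; last exact: ppoly_cst.
  rewrite (_ : intOm Om (fun=> 0) = 0) ?addr0//.
  by rewrite /intOm; under eq_fun do rewrite mulr0; exact: iint0.
apply: intOm_le.
- by apply: ppolyM; apply: ppoly_sum => i; apply: ppoly_pd; exact: ppoly_combo.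
- by apply: ppolyD; [apply: ppolyM => //; exact: ppoly_cst|exact: ppoly_cst].
move=> x _; rewrite addr0 -expr2.
have := sqr_sum_le (fun i => pd (combo phi a) i i x).
rewrite card_ord => /le_trans; apply; rewrite ler_wpM2l//.
apply: ler_sum => i _; rewrite (bigD1 i)//= -expr2 lerDl.
by apply: sumr_ge0 => k _; rewrite -expr2 sqr_ge0.
Qed.

(* The divergence of [x_last v_j^2] integrates to zero, and pointwise it is
   [v_j^2 + 2 x_last v_j d_last v_j >= v_j^2 / 2 - 2 L^2 (d_last v_j)^2]. *)
Lemma poincare a :
  dot a (mass_mx *m a) <= 4 * L ^+ 2 * dot a (grad_mx *m a).
Proof.
rewrite -ip_combo -ipgrad_combo.
set v := combo phi a; pose z := ord_max : 'I_n.+1.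
pose e : 'rV[R]_n.+1 := delta_mx ord0 z.
pose W j (x : 'rV[R]_n.+1) : R := x ord0 z * (v x ord0 j * v x ord0 j).
have ppv j : ppoly T (fun x => v x ord0 j) by exact: ppoly_combo.
have ppz : ppoly T (fun x : 'rV[R]_n.+1 => x ord0 z) by apply: ppoly_polyc; exact: polyc_coord.
have ppW j : ppoly T (W j) by apply: ppolyM => //; exact: ppolyM.
have intW j : intOm Om ('D_e (W j)) = 0.
  apply: (intOm_derive_last Tmesh Om_regular L0 OmL) => //.
    move=> x; have cv : {for x, continuous (fun y => v y ord0 j)}.
      exact: combo_continuous.
    have cz : {for x, continuous (fun y : 'rV[R]_n.+1 => y ord0 z)}.
      exact: coord_continuous.
    exact: continuousM cz (continuousM cv cv).
  by move=> x nOx; rewrite /W /v combo_out// mxE !mulr0.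
have DW j m x : open_simplex (T m) x -> 'D_e (W j) x =
    v x ord0 j * v x ord0 j + 2 * (x ord0 z * (v x ord0 j * pd v j z x)).
  move=> xm.
  have dv := ppoly_is_derive Tmesh e (ppv j) xm.
  have dz := is_derive_coord z x e.
  have dW := is_deriveM dz (is_deriveM dv dv).
  transitivity ('D_e ((fun y : 'rV[R]_n.+1 => y ord0 z) *
     ((fun y => v y ord0 j) * (fun y => v y ord0 j))) x); first by [].
  rewrite derive_val /pd -/e /e mxE !eqxx /=.
  set X := x ord0 z; set V := v x ord0 j; set P := 'D__ _ _.
  by transitivity (X * (V * P + V * P) + (V * V) * 1); [|ring].
pose E (x : 'rV[R]_n.+1) : R := \sum_j (v x ord0 j * v x ord0 j + 2 * (x ord0 z * (v x ord0 j * pd v j z x))).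
have pppd j k : ppoly T (pd v j k) by exact: ppoly_pd.
have ppE : ppoly T E.
  apply: ppoly_sum => j; apply: ppolyD; first exact: ppolyM.
  by apply: ppolyM; [exact: ppoly_cst|apply: ppolyM => //; exact: ppolyM].
have intE : intOm Om E = 0.
  rewrite -(intOm_eq Tmesh Om_regular L0 OmL (f := fun x => \sum_j 1 * 'D_e (W j) x) ppE).
    rewrite (intOm_sum Tmesh Om_regular L0 OmL); last by move=> j; exact: (ppoly_derive Tmesh).
    by rewrite big1// => j _; rewrite intW mulr0.
  by move=> m x xm; apply: eq_bigr => j _; rewrite mul1r (DW j m).
have ppg := ppoly_gradsq a.
have ppm : ppoly T (fun x => \sum_i v x ord0 i * v x ord0 i).
  by apply: ppoly_sum => i; exact: ppolyM.
(* Twice the pointwise bound: [V^2 <= 2 (V^2 + 2 X V P) + 4 L^2 S] follows from [(V + 2 X P)^2 >= 0]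
   and [X^2 P^2 <= L^2 S]. The term with [E] integrates to zero, which leaves the constant
   [4 * L ^+ 2]. *)
have : ip Om v v <= intOm Om (fun x =>
   2 * E x + (4 * L ^+ 2) * (\sum_i \sum_k pd v i k x * pd v i k x)).
  apply: intOm_le => //.
    by apply: ppolyD; apply: ppolyM => //; exact: ppoly_cst.
  move=> x Ox; rewrite /E !mulr_sumr -big_split /=; apply: ler_sum => j _.
  have : pd v j z x * pd v j z x <= \sum_k pd v j k x * pd v j k x.
    rewrite (bigD1 z)//= lerDl sumr_ge0// => k _.
    by rewrite -expr2 sqr_ge0.
  have := OmL Ox z; set X := x ord0 z; set V := v x ord0 j.
  set P := pd v j z x; set S := \sum_k _; rewrite ler_norml => /andP[X1 X2] PS.
  have XL : X ^+ 2 <= L ^+ 2 by nra.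
  have h1 : X ^+ 2 * (P * P) <= L ^+ 2 * S.
    by apply: ler_pM => //; rewrite -?expr2 sqr_ge0.
  have h2 : 0 <= (V + 2 * (X * P)) ^+ 2 by exact: sqr_ge0.
  nra.
rewrite (intOm_lin Tmesh Om_regular L0 OmL)//; last by apply: ppolyM => //; exact: ppoly_cst.
rewrite intE mulr0 add0r; move/le_trans; apply.
rewrite le_eqVlt; apply/orP; left; apply/eqP.
have -> : (fun x => 4 * L ^+ 2 * (\sum_i \sum_k pd v i k x * pd v i k x)) =
  (fun x => 4 * L ^+ 2 * (\sum_i \sum_k pd v i k x * pd v i k x) + 0).
  by apply/funext => x; rewrite addr0.
rewrite (intOm_lin Tmesh Om_regular L0 OmL)//; last exact: ppoly_cst.
rewrite (_ : intOm Om (fun=> 0) = 0) ?addr0//.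
by rewrite /intOm; under eq_fun do rewrite mulr0; exact: iint0.
Qed.

(** Makes every finite element function an admissible datum, for the attainment of the maximum. *)
Lemma L2vec_combo a : L2vec Om (combo phi a).
Proof.
apply: (ppoly_L2 Tmesh Om_regular L0 OmL (f := fun x => \sum_i combo phi a x ord0 i ^+ 2)).
apply: ppoly_sum => i; under eq_fun do rewrite expr2.
by apply: ppolyM; exact: ppoly_combo.
Qed.

End FiniteElementForms.

(** * Positive semidefinite matrices and operator norms *)

Section EuclideanForms.
Context {R : realType} {N : nat}.
Implicit Types (a b x y : 'cV[R]_N) (A : 'M[R]_N).

Lemma dotE a b : dot a b = (a^T *m b) ord0 ord0.
Proof. by rewrite mxE; apply: eq_bigr => i _; rewrite mxE. Qed.

Lemma dotC a b : dot a b = dot b a.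
Proof. by apply: eq_bigr => i _; rewrite mulrC. Qed.

Lemma dotDr a b x : dot x (a + b) = dot x a + dot x b.
Proof. by rewrite !dotE mulmxDr mxE. Qed.

Lemma dotZr k a x : dot x (k *: a) = k * dot x a.
Proof. by rewrite !dotE -scalemxAr mxE. Qed.

Lemma dotDl a b x : dot (a + b) x = dot a x + dot b x.
Proof. by rewrite dotC dotDr !(dotC x). Qed.

Lemma dotZl k a x : dot (k *: a) x = k * dot a x.
Proof. by rewrite dotC dotZr dotC. Qed.

Lemma dot_ge0 a : 0 <= dot a a.
Proof. by apply: sumr_ge0 => i _; rewrite -expr2 sqr_ge0. Qed.

Lemma dot_eq0 a : (dot a a == 0) = (a == 0).
Proof.
apply/idP/eqP => [|->]; last by rewrite /dot big1// => i _; rewrite mxE mul0r.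
rewrite psumr_eq0 => [/allP h|i _]; last by rewrite -expr2 sqr_ge0.
apply/matrixP => i j; rewrite [j]ord1 mxE.
by have := h i (mem_index_enum _); rewrite /= mulf_eq0 orbb => /eqP.
Qed.

Lemma dot_gt0 a : a != 0 -> 0 < dot a a.
Proof. by move=> a0; rewrite lt_def dot_eq0 a0 dot_ge0. Qed.

Lemma dot_sym A a b : A^T = A -> dot a (A *m b) = dot b (A *m a).
Proof.
move=> sA; have e : b^T *m (A *m a) = (a^T *m (A *m b))^T by rewrite !trmx_mul trmxK sA mulmxA.
by rewrite !dotE e [RHS]mxE.
Qed.

Lemma vnormE a : vnorm a = Num.sqrt (dot a a).
Proof. by congr Num.sqrt; apply: eq_bigr => i _; rewrite expr2. Qed.

Lemma vnorm_ge0 a : 0 <= vnorm a. Proof. exact: sqrtr_ge0. Qed.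

Lemma sqr_vnorm a : vnorm a ^+ 2 = dot a a.
Proof. by rewrite vnormE sqr_sqrtr// dot_ge0. Qed.

Lemma vnorm_eq0 a : (vnorm a == 0) = (a == 0).
Proof. by rewrite -dot_eq0 -sqr_vnorm sqrf_eq0. Qed.

Lemma vnorm_gt0 a : a != 0 -> 0 < vnorm a.
Proof. by move=> a0; rewrite lt_def vnorm_eq0 a0 vnorm_ge0. Qed.

Definition psd A := A^T = A /\ forall a, 0 <= dot a (A *m a).

Lemma psd1 : psd 1%:M.
Proof. by split=> [|a]; [rewrite trmx1|rewrite mul1mx dot_ge0]. Qed.

(** The form at [a + t *: b] is a nonnegative quadratic in [t]; it is evaluated at its minimizer,
    the degenerate case of a vanishing leading coefficient being separate. *)
Lemma psd_cauchy A a b : psd A ->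
  dot a (A *m b) ^+ 2 <= dot a (A *m a) * dot b (A *m b).
Proof.
move=> [sA pA].
have quad t : 0 <= dot a (A *m a) + 2 * t * dot a (A *m b) + t ^+ 2 * dot b (A *m b).
  have := pA (a + t *: b); rewrite mulmxDr -scalemxAr.
  rewrite !(dotDl, dotDr, dotZl, dotZr) (dot_sym b a sA).
  by set p := dot a _; set q := dot a _; set r := dot b _ => h; nra.
have := quad; have := pA b; set p := dot a _; set q := dot a _; set r := dot b _.
move=> r0 {}quad.
have [r00|rn0] := eqVneq r 0.
  have [->|qn0] := eqVneq q 0; first by rewrite expr0n /= r00 mulr0.
  (* The polynomial is now affine with slope [2 * q]; this [t] gives it the value -1, a
     contradiction. *)
  have := quad (- (p + 1) / (2 * q)); rewrite r00 mulr0 addr0.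
  have -> : 2 * (- (p + 1) / (2 * q)) * q = - (p + 1) by field.
  by rewrite opprD addrA subrr sub0r oppr_ge0 ler10.
have rgt : 0 < r by rewrite lt_def rn0.
have := quad (- q / r).
have -> : p + 2 * (- q / r) * q + (- q / r) ^+ 2 * r = p - q ^+ 2 / r by field.
by rewrite subr_ge0 ler_pdivrMr.
Qed.

Lemma dot_cauchy a b : dot a b <= vnorm a * vnorm b.
Proof.
apply: le_trans (ler_norm _) _; rewrite -sqrtr_sqr !vnormE -sqrtrM ?dot_ge0//.
by rewrite ler_sqrt ?mulr_ge0 ?dot_ge0//; have := psd_cauchy a b psd1; rewrite !mul1mx.
Qed.

(** With [y = A x], Cauchy-Schwarz for the form gives [|y|^4 = (y, A x)^2 <= (y, A y) (x, A x) <= k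
    |y|^2 (x, A x)]; then divide by [|y|^2]. *)
Lemma psd_mulmx_le A k x : psd A -> (forall y, dot y (A *m y) <= k * dot y y) ->
  dot (A *m x) (A *m x) <= k * dot x (A *m x).
Proof.
move=> psdA hk; set y := A *m x.
have [y0|y0] := eqVneq y 0.
  by rewrite y0 /dot !big1 ?mulr0// => i _; rewrite !mxE mulr0.
have yy := dot_gt0 y0.
have h := psd_cauchy y x psdA; rewrite -/y in h.
rewrite -(ler_pM2l yy) -expr2; apply: le_trans h _.
have := hk y; have := proj2 psdA x; rewrite -/y => h1 h2.
by apply: le_trans (ler_wpM2r h1 h2) _; rewrite -mulrA [leRHS]mulrCA.
Qed.

Lemma coercive_unit A k : 0 < k -> A^T = A ->
  (forall x, k * dot x x <= dot x (A *m x)) -> A \in unitmx.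
Proof.
move=> k0 sA hA; rewrite unitmxE unitfE; apply/negP => /det0P[v v0 vA].
have := hA v^T.
have -> : A *m v^T = 0 by rewrite -sA -trmx_mul vA trmx0.
rewrite [leRHS]big1 => [|i _]; last by rewrite !mxE mulr0.
have : 0 < dot v^T v^T by apply: dot_gt0; rewrite trmx_eq0.
by move=> d0; rewrite leNgt mulr_gt0.
Qed.

Lemma opnorm_le A k : 0 <= k -> (forall x, vnorm (A *m x) <= k * vnorm x) ->
  opnorm A <= k.
Proof.
move=> k0 hk; apply: ge_sup; first by exists (vnorm (A *m 0) / vnorm (0 : 'cV[R]_N)); exists 0.
(* The set defining [opnorm] includes [x = 0], whose quotient is 0 because division by zero gives
   zero. *)
move=> _ [x _ <-]; have [->|x0] := eqVneq x 0.
  by rewrite (_ : vnorm 0 = 0) ?invr0 ?mulr0//; apply/eqP; rewrite vnorm_eq0.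
by rewrite ler_pdivrMr ?vnorm_gt0.
Qed.

(** The square of [|A x|] is a polynomial, so it has a maximum on the compact unit sphere, nonempty
    as [0 < N]; other vectors are rescaled. Row vectors are used for compactness. *)
Lemma opnorm_attained A : (0 < N)%N ->
  exists2 c, c != 0 & forall x, vnorm (A *m x) / vnorm x <= vnorm (A *m c) / vnorm c.
Proof.
move=> N0.
pose g (x : 'rV[R]_N) : R := \sum_i (\sum_j A i j * x ord0 j) ^+ 2.
have gE (x : 'rV[R]_N) : g x = dot (A *m x^T) (A *m x^T).
  apply: eq_bigr => i _; rewrite mxE -expr2; congr (_ ^+ 2).
  by apply: eq_bigr => j _; rewrite mxE.
have pg : polyc g.
  apply: polyc_sum => i; apply: polyc_exp; apply: polyc_sum => j.
  by apply: polyc_mul; [exact: polyc_cst|exact: polyc_coord].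
pose s (x : 'rV[R]_N) : R := \sum_j x ord0 j ^+ 2.
have sE (x : 'rV[R]_N) : s x = dot x^T x^T by apply: eq_bigr => j _; rewrite mxE expr2.
have ps : polyc s.
  by apply: polyc_sum => j; apply: polyc_exp; exact: polyc_coord.
pose S := [set x | s x = 1].
have cS : compact S.
  apply: (@subclosed_compact _ S
    [set v : 'rV[R]_N | forall i, `[(-1 : R), 1]%classic (v ord0 i)]).
  - apply: (@closed_comp _ _ s [set y | y = 1]); last exact: closed_eq.
    by move=> x _; exact: polyc_continuous.
  - by apply: (@rV_compact R N (fun=> `[(-1 : R), 1]%classic)) => i; exact: segment_compact.
  - move=> v sv i; rewrite /= in_itv /= -ler_norml -[leRHS](normr1 R) -ler_sqr ?nnegrE//.
    rewrite !real_normK ?num_real// expr1n -sv /s (bigD1 i)//= lerDl.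
    by apply: sumr_ge0 => k _; exact: sqr_ge0.
have S0 : S !=set0.
  exists (delta_mx ord0 (Ordinal N0)); rewrite /S /= /s (bigD1 (Ordinal N0))//=.
  rewrite mxE !eqxx expr1n big1 ?addr0// => j /negbTE j0.
  by rewrite mxE eqxx j0 expr0n.
have cg : {within S, continuous g}.
  by apply: continuous_subspaceT => x; exact: polyc_continuous.
have [c /[!inE] Sc hc] := compact_EVT_max S0 cS cg.
have c1 : vnorm c^T = 1 by rewrite vnormE -sE Sc sqrtr1.
exists c^T; first by rewrite -vnorm_eq0 c1 oner_neq0.
move=> x; rewrite c1 divr1; have [->|x0] := eqVneq x 0.
  rewrite (_ : vnorm 0 = 0) ?invr0 ?mulr0 ?vnorm_ge0//.
  by apply/eqP; rewrite vnorm_eq0.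
have nx := vnorm_gt0 x0.
have Sx : S ((vnorm x)^-1 *: x)^T.
  rewrite /S /= sE trmxK dotZl dotZr -sqr_vnorm; field.
  by rewrite gt_eqF.
rewrite -[leLHS]ger0_norm ?divr_ge0 ?vnorm_ge0// -sqrtr_sqr [leRHS]vnormE.
rewrite ler_sqrt ?dot_ge0// -gE; apply: le_trans (hc _ _); last by rewrite inE; exact: Sx.
rewrite gE trmxK -scalemxAr dotZl dotZr -sqr_vnorm le_eqVlt; apply/orP; left.
by apply/eqP; field; rewrite gt_eqF.
Qed.

Lemma opnorm_max A : (0 < N)%N ->
  exists2 c, c != 0 & opnorm A = vnorm (A *m c) / vnorm c.
Proof.
move=> N0; have [c c0 hc] := opnorm_attained A N0; exists c => //.
apply/eqP; rewrite eq_le; apply/andP; split.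
  apply: ge_sup; first by exists (vnorm (A *m c) / vnorm c); exists c.
  by move=> _ [x _ <-].
apply: ub_le_sup; last by exists c.
by exists (vnorm (A *m c) / vnorm c) => _ [x _ <-].
Qed.

Lemma opnorm_ge A x : (0 < N)%N -> vnorm (A *m x) / vnorm x <= opnorm A.
Proof.
move=> N0; have [c c0 hc] := opnorm_attained A N0.
apply: ub_le_sup; last by exists x.
by exists (vnorm (A *m c) / vnorm c) => _ [y _ <-].
Qed.

Lemma opnorm_ge0 A : (0 < N)%N -> 0 <= opnorm A.
Proof.
by move=> N0; apply: le_trans (opnorm_ge A 0 N0); rewrite divr_ge0// vnorm_ge0.
Qed.

(** With [x = A^-1 y], coercivity and Cauchy-Schwarz give [k |x|^2 <= (x, A x) <= |x| |y|]. *)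
Lemma opnorm_inv_le A k : 0 < k -> A^T = A ->
  (forall x, k * dot x x <= dot x (A *m x)) -> opnorm (invmx A) <= k^-1.
Proof.
move=> k0 sA hA; have uA := coercive_unit k0 sA hA.
apply: opnorm_le => [|y]; first by rewrite invr_ge0 ltW.
set x := invmx A *m y.
have [->|x0] := eqVneq x 0.
  rewrite (_ : vnorm 0 = 0) ?mulr_ge0 ?invr_ge0 ?vnorm_ge0 ?(ltW k0)//.
  by apply/eqP; rewrite vnorm_eq0.
have nx := vnorm_gt0 x0.
rewrite mulrC ler_pdivlMr// -(ler_pM2l nx) mulrA -expr2 sqr_vnorm mulrC.
apply: le_trans (hA x) _.
by rewrite /x mulKVmx//; exact: dot_cauchy.
Qed.

End EuclideanForms.

(** * The penalty matrix *)

Section PenaltyEstimates.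
Context {R : realType} {N : nat}.
Hypothesis N0 : (0 < N)%N.
(** Here [e] stands for [eps^-1], [c2] and [C2] for the constants of (A2), [K] for that of (A1), [P]
    for the Poincare constant and [q] for the dimension. *)
Variables (Mm G D : 'M[R]_N) (h e c2 C2 K P q : R).
Hypotheses (psdM : psd Mm) (psdG : psd G) (psdD : psd D).
Hypotheses (h0 : 0 < h) (e0 : 0 < e) (c20 : 0 < c2) (C20 : 0 < C2) (K0 : 0 <= K)
  (P0 : 0 < P) (q1 : 1 <= q).
Let nN : R := N%:R.
Hypothesis hM1 : forall a, c2 ^+ 2 / nN * dot a a <= dot a (Mm *m a).
Hypothesis hM2 : forall a, dot a (Mm *m a) <= C2 ^+ 2 / nN * dot a a.
Hypothesis hG : forall a, dot a (G *m a) <= (K / h) ^+ 2 * dot a (Mm *m a).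
Hypothesis hP : forall a, dot a (Mm *m a) <= P * dot a (G *m a).
Hypothesis hD : forall a, dot a (D *m a) <= q * dot a (G *m a).

Let A := G + e *: D.
Let nN0 : 0 < nN. Proof. by rewrite ltr0n. Qed.
Let s := Num.sqrt nN.
Let s0 : 0 < s. Proof. by rewrite sqrtr_gt0. Qed.
Let sE : s ^+ 2 = nN. Proof. by rewrite sqr_sqrtr// ltW. Qed.
Let q0 : 0 < q. Proof. exact: lt_le_trans ltr01 q1. Qed.

(** For [Mm], [G] and [D] these are the norms of the finite element function, of its gradient and of
    its divergence. *)
Definition form_norm (B : 'M[R]_N) (a : 'cV[R]_N) : R := Num.sqrt (dot a (B *m a)).

Lemma form_norm_cauchy B a b : psd B ->
  dot a (B *m b) <= form_norm B a * form_norm B b.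
Proof.
move=> psdB; have [_ pB] := psdB.
apply: le_trans (ler_norm _) _; rewrite -sqrtr_sqr -sqrtrM ?pB//.
by rewrite ler_sqrt ?mulr_ge0 ?pB//; exact: psd_cauchy.
Qed.

Lemma form_norm_le B B' k a : 0 <= k ->
  dot a (B *m a) <= k ^+ 2 * dot a (B' *m a) ->
  form_norm B a <= k * form_norm B' a.
Proof.
move=> k0 hk; rewrite -{1}[k](ger0_norm k0) -sqrtr_sqr -sqrtrM ?sqr_ge0//.
have [hB|hB] := lerP 0 (k ^+ 2 * dot a (B' *m a)); first by rewrite ler_sqrt.
by rewrite /form_norm ler0_sqrtr ?sqrtr_ge0// (le_trans hk)// ltW.
Qed.

Lemma penalty_dot a b : dot a (A *m b) = dot a (G *m b) + e * dot a (D *m b).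
Proof. by rewrite mulmxDl dotDr -scalemxAl dotZr. Qed.

Lemma penalty_psd : psd A.
Proof.
split=> [|a].
  by rewrite /A linearD /= linearZ /= (proj1 psdG) (proj1 psdD).
by rewrite penalty_dot addr_ge0 ?(proj2 psdG)// mulr_ge0 ?(proj2 psdD)// ltW.
Qed.

Let lam := c2 ^+ 2 / nN / P.
Let lam0 : 0 < lam. Proof. by rewrite !divr_gt0// exprn_gt0. Qed.

(** The penalty term is nonnegative and is dropped, so [lam] does not depend on [e]; (A2) and
    Poincare bound the gradient term from below. *)
Lemma penalty_coercive a : lam * dot a a <= dot a (A *m a).
Proof.
apply: (@le_trans _ _ (dot a (G *m a))).
  rewrite /lam mulrAC ler_pdivrMr// mulrC [leRHS]mulrC.
  by rewrite mulrC; apply: le_trans (hM1 a) (hP a).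
by rewrite penalty_dot lerDl mulr_ge0 ?(proj2 psdD)// ltW.
Qed.

Lemma penalty_inv_le : opnorm (invmx A) <= lam^-1.
Proof. exact: opnorm_inv_le lam0 (proj1 penalty_psd) penalty_coercive. Qed.

Let Lam := (1 + e * q) * ((K / h) ^+ 2 * (C2 ^+ 2 / nN)).
Let Lam0 : 0 <= Lam.
Proof.
have eq0 : 0 <= 1 + e * q by rewrite addr_ge0// mulr_ge0// ltW.
by rewrite /Lam mulr_ge0// mulr_ge0 ?sqr_ge0// divr_ge0 ?sqr_ge0// ltW.
Qed.

Lemma penalty_bounded a : dot a (A *m a) <= Lam * dot a a.
Proof.
apply: (@le_trans _ _ ((1 + e * q) * dot a (G *m a))).
  by rewrite penalty_dot mulrDl mul1r lerD2l -mulrA ler_pM2l.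
rewrite /Lam -mulrA ler_wpM2l ?addr_ge0 ?mulr_ge0 ?(ltW e0) ?(ltW q0)//.
apply: le_trans (hG a) _; rewrite -mulrA ler_wpM2l ?sqr_ge0//.
Qed.

(** By [psd_mulmx_le], [|A x|^2 <= Lam (x, A x) <= Lam^2 |x|^2]. *)
Lemma penalty_opnorm_le : opnorm A <= Lam.
Proof.
apply: opnorm_le => // x.
have L0 : 0 <= Lam * vnorm x by apply: mulr_ge0 => //; exact: vnorm_ge0.
rewrite -ler_sqr ?nnegrE ?vnorm_ge0//.
rewrite exprMn !sqr_vnorm; apply: le_trans (psd_mulmx_le x penalty_psd penalty_bounded) _.
by rewrite expr2 -mulrA ler_wpM2l// penalty_bounded.
Qed.

(** The factor [nN] in [lam^-1] cancels the [nN^-1] in [Lam]. *)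
Lemma penalty_cond_le :
  cond A <= P * C2 ^+ 2 / c2 ^+ 2 * K ^+ 2 * (1 + e * q) * h ^- 2.
Proof.
apply: (@le_trans _ _ (Lam * lam^-1)).
  by apply: ler_pM; rewrite ?opnorm_ge0 ?penalty_opnorm_le ?penalty_inv_le.
rewrite le_eqVlt; apply/orP; left; apply/eqP; rewrite /Lam /lam.
by field; rewrite !gt_eqF.
Qed.

Lemma mass_norm_le a : form_norm Mm a <= C2 / s * vnorm a.
Proof.
have -> : vnorm a = form_norm 1%:M a by rewrite vnormE /form_norm mul1mx.
apply: form_norm_le; first by rewrite divr_ge0 ?ltW.
by rewrite mul1mx expr_div_n sE; exact: hM2.
Qed.

Lemma mass_mulmx_le g : vnorm (Mm *m g) <= C2 / s * form_norm Mm g.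
Proof.
rewrite -ler_sqr ?nnegrE ?mulr_ge0 ?vnorm_ge0 ?sqrtr_ge0 ?invr_ge0 ?(ltW C20) ?(ltW s0)//.
rewrite sqr_vnorm exprMn sqr_sqrtr ?(proj2 psdM)// expr_div_n sE.
exact: psd_mulmx_le psdM hM2.
Qed.

(** Test [A c] with [y = A c] and use Cauchy-Schwarz for [G] and [D] separately. In the penalty term
    the inverse estimate is spent on [y] only and the divergence of [c] is kept, so [e] meets a
    single power of [h^-1]. *)
Lemma penalty_mulmx_le c : vnorm (A *m c) <=
  C2 / s * (K / h * (K / h * form_norm Mm c + e * q * form_norm D c)).
Proof.
have Kh : 0 <= K / h by rewrite divr_ge0// ltW.
set y := A *m c.
have C2s : 0 <= C2 / s by rewrite divr_ge0 ?ltW.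
have fn B a : 0 <= form_norm B a by exact: sqrtr_ge0.
have Gn a : form_norm G a <= K / h * form_norm Mm a by apply: form_norm_le.
(* As [1 <= q], the factor [q] is bounded by its square, so [q] can stand in for its square root. *)
have Dn a : form_norm D a <= q * (K / h * form_norm Mm a).
  rewrite mulrA; apply: form_norm_le; first by rewrite mulr_ge0// ltW.
  apply: le_trans (hD a) _; rewrite exprMn [q ^+ 2]expr2 -2!mulrA ler_pM2l//.
  apply: le_trans (hG a) _; apply: ler_peMl => //.
  by rewrite mulr_ge0 ?sqr_ge0//; exact: (proj2 psdM).
set X := K / h * form_norm Mm c + e * q * form_norm D c.
have X0 : 0 <= X.
  apply: addr_ge0; first exact: mulr_ge0.
  by apply: mulr_ge0 => //; apply: mulr_ge0; exact: ltW.
have [y0|y0] := eqVneq y 0.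
  rewrite (_ : vnorm y = 0); first by do 2![apply: mulr_ge0 => //].
  by apply/eqP; rewrite vnorm_eq0 y0.
have ny := vnorm_gt0 y0.
rewrite -(ler_pM2l ny) -expr2 sqr_vnorm {2}/y penalty_dot.
have h1 : dot y (G *m c) <= K / h * form_norm Mm y * (K / h * form_norm Mm c).
  by apply: le_trans (form_norm_cauchy y c psdG) _; apply: ler_pM.
have h2 : dot y (D *m c) <= q * (K / h * form_norm Mm y) * form_norm D c.
  by apply: le_trans (form_norm_cauchy y c psdD) _; apply: ler_pM.
have h3 : dot y (G *m c) + e * dot y (D *m c) <= form_norm Mm y * (K / h * X).
  have -> : form_norm Mm y * (K / h * X) =
     K / h * form_norm Mm y * (K / h * form_norm Mm c) +
     e * (q * (K / h * form_norm Mm y) * form_norm D c) by rewrite /X; ring.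
  by rewrite lerD// ler_pM2l.
apply: le_trans h3 _.
rewrite [leRHS]mulrA; apply: ler_wpM2r; first exact: mulr_ge0.
by rewrite mulrC; exact: mass_norm_le.
Qed.

(** The factor [nN] of [lam^-1] is absorbed by one [s^-1] from the bound on [A c] and another from
    [mass_norm_le]. The quantity [B] stays open so that both estimates of [|A c|] can be
    inserted. *)
Lemma eff_cond_le c B : 0 <= B -> vnorm (A *m c) <= C2 / s * B ->
  eff_cond A c <= P * C2 ^+ 2 / c2 ^+ 2 * (B / form_norm Mm c).
Proof.
move=> B0 hB; rewrite /eff_cond.
have k0 : 0 <= P * C2 ^+ 2 / c2 ^+ 2 by rewrite !mulr_ge0 ?invr_ge0 ?sqr_ge0 ?ltW.
have [->|cn0] := eqVneq c 0.
  rewrite (_ : vnorm 0 = 0) ?invr0 ?mulr0; last by apply/eqP; rewrite vnorm_eq0.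
  by rewrite mulr_ge0// divr_ge0// sqrtr_ge0.
have nc := vnorm_gt0 cn0.
have mc : 0 < form_norm Mm c.
  rewrite sqrtr_gt0; apply: lt_le_trans (hM1 c).
  by rewrite mulr_gt0 ?dot_gt0// divr_gt0// exprn_gt0.
apply: (@le_trans _ _ (lam^-1 * (C2 / s * B) / vnorm c)).
  rewrite ler_wpM2r ?invr_ge0 ?vnorm_ge0//.
  by apply: ler_pM; rewrite ?opnorm_ge0 ?vnorm_ge0 ?penalty_inv_le.
rewrite ler_pdivrMr//.
have -> : lam^-1 * (C2 / s * B) =
    P * C2 ^+ 2 / c2 ^+ 2 * (B / form_norm Mm c) * (form_norm Mm c * s / C2).
  by rewrite /lam -sE; field; rewrite !gt_eqF.
apply: ler_wpM2l; first by apply: mulr_ge0 => //; exact: divr_ge0 B0 (ltW mc).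
rewrite ler_pdivrMr//; apply: le_trans (ler_wpM2r (ltW s0) (mass_norm_le c)) _.
by rewrite le_eqVlt; apply/orP; left; apply/eqP; field; rewrite gt_eqF.
Qed.

End PenaltyEstimates.


(** * From finite element data to coefficient vectors *)

Section FiniteElementBasis.
Context {R : realType}.

Lemma FE_basis_regular n (Om : set 'rV[R]_n.+1) h N
    (phi : 'I_N -> 'rV[R]_n.+1 -> 'rV[R]_n.+1) : FE_basis Om h phi ->
  exists (M : nat) (T : 'I_M -> 'I_n.+2 -> 'rV[R]_n.+1),
  [/\ mesh Om h T, forall i, continuous (phi i),
      forall i x, ~ Om x -> phi i x = 0
    & forall i j, ppoly T (fun x => phi i x ord0 j)].
Proof.
move=> [M [T [meshT cphi out bd poly]]]; exists M, T; split => //.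
  move=> i x nOx; have [clx|nclx] := pselect (closure Om x); last exact: out.
  by apply: bd; split.
move=> i j m; have [g [/is_polyfun_polyc pg hg]] := poly i m j.
by exists g.
Qed.

Lemma dot_inj N (x y : 'cV[R]_N) : (forall a, dot a x = dot a y) -> x = y.
Proof.
move=> hxy; apply/eqP; rewrite -subr_eq0 -dot_eq0.
have -> : x - y = x + -1 *: y by rewrite scaleN1r.
by rewrite dotDr dotZr -!hxy; apply/eqP; ring.
Qed.

End FiniteElementBasis.


(** * Assembly of the estimates with one constant for all [h] and [eps] *)

Unset Implicit Arguments.

Theorem theorem2p1 (R : realType) (d : nat) (hd : d = 2%N \/ d = 3%N)
  (Om : set 'rV[R]_d) (HOm : polyhedral_domain Om)
  (Hs : set R) (Hpos : forall h, Hs h -> 0 < h)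
  (N : R -> nat) (phi : forall h : R, 'I_(N h) -> 'rV[R]_d -> 'rV[R]_d)
  (HX : forall h, Hs h -> FE_basis Om h (phi h))
  (* (A1) inverse estimate *)
  (CA1 : R)
  (HA1 : forall h, Hs h -> forall a : 'cV[R]_(N h),
     gradnorm Om (combo (phi h) a) <= CA1 * h^-1 * l2norm Om (combo (phi h) a))
  (* (A2) N = C h^-d and norm equivalence *)
  (cN CN : R) (HcN : 0 < cN)
  (HN : forall h, Hs h -> cN * h ^- d <= (N h)%:R <= CN * h ^- d)
  (c2 C2 : R) (Hc2 : 0 < c2)
  (HA2 : forall h, Hs h -> forall a : 'cV[R]_(N h),
     c2 * Num.sqrt ((N h)%:R^-1 * \sum_i a i ord0 ^+ 2) <= l2norm Om (combo (phi h) a)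
     <= C2 * Num.sqrt ((N h)%:R^-1 * \sum_i a i ord0 ^+ 2)) :
  exists C : R, 0 < C /\
  forall h, Hs h -> forall eps : R, 0 < eps ->
    let A := penalty_matrix Om (phi h) eps in
    [/\ (* max over the data of kappa(u^eps) equals kappa *)
        (forall f, L2vec Om f -> forall c, penalty_sol Om (phi h) eps f c ->
           eff_cond A c <= cond A),
        (exists f, L2vec Om f /\ exists c, penalty_sol Om (phi h) eps f c /\
           eff_cond A c = cond A),
        cond A <= C * (h ^- 2 + eps^-1 * h ^- 2) &
        forall f, L2vec Om f -> forall (c g : 'cV[R]_(N h)),
          penalty_sol Om (phi h) eps f c -> L2proj Om (phi h) f g ->
          eff_cond A c <= C * (l2norm Om (combo (phi h) g) / l2norm Om (combo (phi h) c))
          /\ eff_cond A c <= C * h ^- 2 * (1 + h / eps *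
               (divnorm Om (combo (phi h) c) / l2norm Om (combo (phi h) c)))].
Proof.
have {hd} [n dn] : exists n, d = n.+1.
  by case: hd => ->; [exists 1%N|exists 2%N].
subst d.
have [L [L0 OmL]] := polyhedral_bounded HOm.
have Om_reg := polyhedral_regular HOm.
have L0' := ltW L0.
(* Absolute values, and the added 1, give [0 <= K] and [0 < C'] while only enlarging the upper
   bounds. *)
pose K : R := `|CA1|; pose C' : R := `|C2| + 1; pose q : R := n.+1%:R.
pose P : R := 4 * L ^+ 2.
have K0 : 0 <= K by exact: normr_ge0.
have C'0 : 0 < C' by rewrite ltr_wpDl.
have P0 : 0 < P by rewrite mulr_gt0// exprn_gt0.
have q1 : 1 <= q by rewrite ler1n.
pose C0 : R := P * C' ^+ 2 / c2 ^+ 2.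
have C00 : 0 < C0 by rewrite divr_gt0 ?mulr_gt0 ?exprn_gt0.
have q0 : 0 < q by exact: lt_le_trans ltr01 q1.
(* [C0] is the prefactor common to all estimates. The other factor dominates 1, [K ^+ 2] and
   [K * q], and after multiplication by [1 + eps^-1] also [K ^+ 2 * (1 + eps^-1 * q)]. *)
exists (C0 * ((1 + K) ^+ 2 * (1 + q))); split.
  rewrite mulr_gt0// mulr_gt0 ?exprn_gt0//; first by rewrite ltr_pwDl.
  by rewrite addr_gt0.
move=> h Hh eps eps0; have h0 := Hpos _ Hh.
have N0 : (0 < N h)%N.
  have /andP[lo _] := HN _ Hh; rewrite -(ltr0n R); apply: lt_le_trans lo.
  by rewrite mulr_gt0// invr_gt0 exprn_gt0.
have nN0 : 0 < (N h)%:R :> R by rewrite ltr0n.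
have [M [T [meshT cphi phi0 ppphi]]] := FE_basis_regular (HX _ Hh).
set F := phi h in cphi phi0 ppphi *.
pose Mm := mass_mx Om F; pose G := grad_mx Om F; pose D := div_mx Om F.
have ipE := ip_combo meshT Om_reg L0' OmL ppphi.
have gradE := ipgrad_combo meshT Om_reg L0' OmL ppphi.
have divE := ipdiv_combo meshT Om_reg L0' OmL ppphi.
have psdM : psd Mm.
  by split; [exact: mass_mx_sym|exact: (mass_mx_ge0 meshT Om_reg L0' OmL ppphi)].
have psdG : psd G.
  by split; [exact: grad_mx_sym|exact: (grad_mx_ge0 meshT Om_reg L0' OmL ppphi)].
have psdD : psd D.
  by split; [exact: div_mx_sym|exact: (div_mx_ge0 meshT Om_reg L0' OmL ppphi)].
have l2E a : l2norm Om (combo F a) = form_norm Mm a by rewrite /l2norm ipE.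
have gnE a : gradnorm Om (combo F a) = form_norm G a by rewrite /gradnorm gradE.
have dnE a : divnorm Om (combo F a) = form_norm D a by rewrite /divnorm divE.
have sumE (a : 'cV[R]_(N h)) : \sum_i a i ord0 ^+ 2 = dot a a.
  by apply: eq_bigr => i _; rewrite expr2.
have ndot (a : 'cV[R]_(N h)) : 0 <= (N h)%:R^-1 * dot a a.
  by rewrite mulr_ge0 ?dot_ge0// invr_ge0 ltW.
have hM1 a : c2 ^+ 2 / (N h)%:R * dot a a <= dot a (Mm *m a).
  have /andP[lo _] := HA2 _ Hh a; rewrite l2E sumE in lo.
  rewrite -mulrA -[X in _ * X]sqr_sqrtr// -exprMn.
  rewrite -[leRHS]sqr_sqrtr ?(proj2 psdM)// ler_sqr ?nnegrE ?sqrtr_ge0//.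
  by rewrite mulr_ge0 ?sqrtr_ge0// ltW.
have hM2 a : dot a (Mm *m a) <= C' ^+ 2 / (N h)%:R * dot a a.
  have /andP[_ up] := HA2 _ Hh a; rewrite l2E sumE in up.
  rewrite -mulrA -[X in _ <= _ * X]sqr_sqrtr// -exprMn.
  rewrite -[leLHS]sqr_sqrtr ?(proj2 psdM)// ler_sqr ?nnegrE ?sqrtr_ge0//; last first.
    by rewrite mulr_ge0 ?sqrtr_ge0// ltW.
  apply: le_trans up _; rewrite ler_wpM2r ?sqrtr_ge0//.
  by rewrite (le_trans (ler_norm _))// lerDl.
have hG a : dot a (G *m a) <= (K / h) ^+ 2 * dot a (Mm *m a).
  have up := HA1 _ Hh a; rewrite gnE l2E in up.
  rewrite -[dot a (Mm *m a)]sqr_sqrtr ?(proj2 psdM)// -exprMn.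
  rewrite -[leLHS]sqr_sqrtr ?(proj2 psdG)// ler_sqr ?nnegrE ?sqrtr_ge0//; last first.
    by rewrite mulr_ge0 ?sqrtr_ge0// divr_ge0// ltW.
  apply: le_trans up _; rewrite ler_wpM2r ?sqrtr_ge0//.
  by rewrite ler_wpM2r ?invr_ge0 ?ler_norm// ltW.
have hP a : dot a (Mm *m a) <= P * dot a (G *m a).
  exact: (poincare meshT Om_reg L0' OmL cphi phi0 ppphi).
have hD a : dot a (D *m a) <= q * dot a (G *m a).
  exact: (div_le_grad meshT Om_reg L0' OmL ppphi).
have e0 : 0 < eps^-1 by rewrite invr_gt0.
rewrite penalty_matrixE -/G -/D; set A := G + eps^-1 *: D.
move=> A'; rewrite {}/A'.
(* The datum and its projection have the same inner products with all basis combinations, so the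
   load vector is [Mm *m g]. *)
have solE f c g : penalty_sol Om F eps f c -> L2proj Om F f g -> A *m c = Mm *m g.
  move=> hc hg; apply: dot_inj => a.
  have := hc a; rewrite -hg ipE gradE divE -penalty_dot.
  by rewrite (dot_sym _ _ (proj1 (penalty_psd psdG psdD e0))) => ->; rewrite (dot_sym _ _ (proj1 psdM)).
have k1 : K ^+ 2 <= (1 + K) ^+ 2 * (1 + q).
  have : 0 <= q * (1 + K) ^+ 2 by rewrite mulr_ge0 ?sqr_ge0// ltW.
  by move: K0; clear; nra.
have k2 : K * q <= (1 + K) ^+ 2 * (1 + q).
  have : 0 <= q * (1 + K + K ^+ 2) by rewrite mulr_ge0 ?(ltW q0)// !addr_ge0// sqr_ge0.
  by move: K0; clear; nra.
have k3 : 1 <= (1 + K) ^+ 2 * (1 + q) by move: K0 q0; clear; nra.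
split.
- move=> f _ c _; rewrite /eff_cond /cond -mulrA [leRHS]mulrC.
  by rewrite ler_wpM2l ?opnorm_ge0 ?opnorm_ge.
- have [c c0 cmax] := opnorm_max A N0.
  have uM : Mm \in unitmx.
    by apply: coercive_unit (proj1 psdM) hM1; rewrite divr_gt0// exprn_gt0.
  pose g := invmx Mm *m (A *m c).
  exists (combo F g); split; first exact: (L2vec_combo meshT Om_reg L0' OmL ppphi).
  exists c; split; last by rewrite /eff_cond /cond cmax -mulrA mulrC.
  move=> a; rewrite ipE gradE divE -penalty_dot.
  rewrite (dot_sym _ _ (proj1 (penalty_psd psdG psdD e0))) (dot_sym _ _ (proj1 psdM)).
  by rewrite /g mulKVmx.
- have := penalty_cond_le N0 psdG psdD h0 e0 Hc2 P0 q1 hM1 hM2 hG hP hD.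
  move/le_trans; apply.
  have -> : C0 * ((1 + K) ^+ 2 * (1 + q)) * (h ^- 2 + eps^-1 * h ^- 2) =
    C0 * ((1 + K) ^+ 2 * ((1 + q) * (1 + eps^-1))) * h ^- 2 by ring.
  rewrite ler_wpM2r ?invr_ge0 ?exprn_ge0 ?(ltW h0)//.
  rewrite -/C0 -mulrA ler_pM2l//.
  apply: ler_pM; [exact: sqr_ge0| | |].
  + by rewrite addr_ge0// mulr_ge0// ltW.
  + by rewrite ler_sqr ?nnegrE ?addr_ge0// lerDr.
  + have := ltW e0; have := ltW q0; set e := eps^-1.
    by clear; nra.
- move=> f _ c g hc hg.
  have Ac := solE _ _ _ hc hg.
  have fn (B : 'M[R]_(N h)) a : 0 <= form_norm B a by exact: sqrtr_ge0.
  have eff := eff_cond_le N0 psdG psdD e0 Hc2 C'0 P0 hM1 hM2 hP.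
  rewrite !l2E dnE; split.
    have hB : vnorm (A *m c) <= C' / Num.sqrt (N h)%:R * form_norm Mm g.
      by rewrite Ac; exact: mass_mulmx_le.
    apply: le_trans (eff _ _ (fn _ _) hB) _; rewrite -/C0.
    apply: ler_wpM2r; first exact: divr_ge0.
    by rewrite ler_peMr// ltW.
  have hB := penalty_mulmx_le N0 psdM psdG psdD h0 e0 C'0 K0 q1 hM2 hG hD c.
  have Kh : 0 <= K / h by rewrite divr_ge0// ltW.
  have B0 : 0 <= K / h * (K / h * form_norm Mm c + eps^-1 * q * form_norm D c).
    apply: mulr_ge0 => //; apply: addr_ge0; first exact: mulr_ge0.
    by apply: mulr_ge0 => //; apply: mulr_ge0; exact: ltW.
  apply: le_trans (eff _ _ B0 hB) _; rewrite -/C0 -2![leRHS]mulrA.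
  rewrite ler_pM2l//; set r := form_norm D c / form_norm Mm c.
  have r0 : 0 <= r by exact: divr_ge0.
  have i0 : 0 <= h^-1 by rewrite invr_ge0 ltW.
  have hr : 0 <= h^-1 * eps^-1 * r by rewrite mulr_ge0// mulr_ge0// ltW.
  have kk := le_trans ler01 k3.
  have -> : (1 + K) ^+ 2 * (1 + q) * (h ^- 2 * (1 + h / eps * r)) =
     (1 + K) ^+ 2 * (1 + q) * h^-1 ^+ 2 + (1 + K) ^+ 2 * (1 + q) * (h^-1 * eps^-1 * r).
    by field; rewrite !gt_eqF.
  (* If the norm of the solution is 0, division by zero makes the left-hand side 0. *)
  have [mc0|mc0] := eqVneq (form_norm Mm c) 0.
    rewrite mc0 invr0 mulr0; apply: addr_ge0; last exact: mulr_ge0.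
    by apply: mulr_ge0 => //; exact: sqr_ge0.
  have -> : K / h * (K / h * form_norm Mm c + eps^-1 * q * form_norm D c) / form_norm Mm c =
     K ^+ 2 * h^-1 ^+ 2 + K * q * (h^-1 * eps^-1 * r).
    by rewrite /r; field; rewrite mc0 !gt_eqF.
  by apply: lerD; apply: ler_wpM2r => //; exact: sqr_ge0.
Qed.
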